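(* Let $J\subset\mathbb{C}$ be a Jordan curve and let $\gamma:\mathbb{R}/2\pi\mathbb{Z}\to\mathbb{C}$ be a homeomorphic parametrization of $J$ (which fixes the orientation of $J$) with $\gamma(0)=A_0$. Assume that $J$ has continuously turning tangents in a neighborhood of $A_0$. Let $n\ge 3$ and let $a_1,\dots,a_n>0$ satisfy $a_i<\sum_{j\neq i}a_j$ for every $i=1,\dots,n$. Then there exist parameters $0=\sigma_0<\sigma_1<\dots<\sigma_{n-1}<\sigma_n=2\pi$ and a number $\lambda>0$ such that \[ |\gamma(\sigma_i)-\gamma(\sigma_{i-1})|=\lambda a_i\quad\text{for } i=1,\dots,n . \] Equivalently, there is a neatly $J$-cyclic polygon with consecutive side lengths $a_1,\dots,a_n$ whose inscribed similar copy has starting vertex $A_0$.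
   Context: A polygon $Q_n=A_0A_1\cdots A_{n-1}$ is an oriented closed piecewise linear curve with vertices $A_0,\dots,A_{n-1}$ and sides $A_0A_1,\dots,A_{n-2}A_{n-1},A_{n-1}A_0$. For an oriented Jordan curve $J$, $Q_n$ is called neatly $J$-cyclic if it has a similar copy $A_0'A_1'\cdots A_{n-1}'$ whose vertices lie on $J$ and are arranged on $J$ in this order according to the orientation of $J$. ''$J$ has continuously turning tangents in a neighborhood of $A_0$'' means: there is an open arc $B\subset J$ containing $A_0$ admitting a parametrization $h:(\alpha,\beta)\to B$ that is continuously differentiable with $h'(t)\neq 0$ for all $t$. *)

(* Defs.v *)
From Stdlib Require Export Reals.
From Coquelicot Require Export Coquelicot.
Open Scope R_scope.

Definition pdist (p q : R * R) : R :=
  sqrt ((fst p - fst q) ^ 2 + (snd p - snd q) ^ 2).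

(* gamma : R -> C is 2pi-periodic, continuous and injective on [0, 2pi):
   i.e. it induces a continuous injection R/2piZ -> C, which (the circle being
   compact) is a homeomorphism onto its image J. *)
Definition jordan_param (gamma : R -> R * R) : Prop :=
  (forall s, gamma (s + 2 * PI) = gamma s) /\
  (forall s, continuity_pt (fun t => fst (gamma t)) s /\
             continuity_pt (fun t => snd (gamma t)) s) /\
  (forall s t, 0 <= s < 2 * PI -> 0 <= t < 2 * PI -> gamma s = gamma t -> s = t).

Definition curve (gamma : R -> R * R) (p : R * R) : Prop :=
  exists s, gamma s = p.

(* J has continuously turning tangents in a neighborhood of A0:
   there is an open arc B of J containing A0 (an injective continuous image of
   an open interval (alpha,beta), relatively open in J) with a C^1
   parametrization h : (alpha,beta) -> B with h' <> 0. *)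
Definition cont_turning_tangents_at (J : R * R -> Prop) (A0 : R * R) : Prop :=
  exists (alpha beta : R) (h : R -> R * R) (d1 d2 : R -> R),
    alpha < beta /\
    (forall t, alpha < t < beta -> J (h t)) /\
    (forall s t, alpha < s < beta -> alpha < t < beta -> h s = h t -> s = t) /\
    (exists t0, alpha < t0 < beta /\ h t0 = A0) /\
    (forall t, alpha < t < beta -> exists eps, 0 < eps /\
        forall p, J p -> pdist p (h t) < eps ->
          exists u, alpha < u < beta /\ h u = p) /\
    (forall t, alpha < t < beta ->
        is_derive (fun u => fst (h u)) t (d1 t) /\
        is_derive (fun u => snd (h u)) t (d2 t) /\
        continuous d1 t /\ continuous d2 t /\
        (d1 t, d2 t) <> (0, 0)).

Definition sum_except (a : nat -> R) (n i : nat) : R :=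
  sum_f_R0 (fun k => if Nat.eq_dec (S k) i then 0 else a (S k)) (n - 1).

(* Main.v *)
(* Cut the circle [0, 2 PI] into [n] consecutive pieces and let [f_i] be the chord spanned
   by the [i]-th piece, [S] their sum, [A] the sum of the [a_i].  The sets
   "[A f_i <= a_i S] and the [i]-th piece is not almost the whole circle" are closed.  They
   cover all partitions: by averaging if no piece is almost the whole circle; otherwise
   every vertex is near [gamma 0], where the C^1 tangent makes the long piece's chord almost
   the sum of the others, hence more than its share because [a_k < A - a_k], so one of the
   others gets at most its share.  A KKM-type theorem gives a partition that is in all these
   sets except perhaps those of pieces of length [0], which meet the inequality trivially;
   summing, all the inequalities are equalities, and [S > 0] since no piece is too long.

   The KKM theorem follows by compactness from Scarf's lemma on finite sets carrying one
   linear order per index: call a set dominant if every element is below all of it in some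
   order; an (|I| - 1)-element dominant set extends to exactly two dominant |I|-element sets,
   except on the boundary, and a Sperner parity count yields one with all colors. *)
Require Import Defs.
From Stdlib Require Import ZArith Lra Lia Classical ClassicalEpsilon.
From mathcomp Require all_boot.
Open Scope R_scope.

(** * Scarf's lemma and a discrete covering theorem *)

Definition partition_to (n N : nat) (s : nat -> nat) : Prop :=
  s 0%nat = 0%nat /\ s n = N /\ forall i, (i < n)%nat -> (s i <= s (S i))%nat.

Module Combinatorics.
Import mathcomp.boot.all_boot.
Local Open Scope nat_scope.

Section Scarf.
Variables (I Z : finType) (r : I -> Z -> nat).
Hypothesis r_inj : forall i, injective (r i).

(** Taking [y] in [B] shows that each element of a dominant [B] is its least element in some order,
    so [B] has at most [#|I|] elements. *)
Definition dominant (B : {set Z}) :=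
  [forall y, [exists i, [forall b in B, r i y <= r i b]]].

Lemma dominantP (B : {set Z}) :
  reflect (forall y, exists i, forall b, b \in B -> r i y <= r i b) (dominant B).
Proof.
apply: (iffP forallP) => H y.
  by have /existsP[i /forall_inP Hi] := H y; exists i.
by have [i Hi] := H y; apply/existsP; exists i; apply/forall_inP.
Qed.

Lemma dominant_sub (A B : {set Z}) : A \subset B -> dominant B -> dominant A.
Proof.
move=> sAB /dominantP H; apply/dominantP => y; have [i Hi] := H y.
by exists i => b bA; apply/Hi/(subsetP sAB).
Qed.

(* [m k] is the [k]-least element of [D].  When [#|D| = #|I| - 1], exactly one value of [m]
   is taken twice, at [i] and [j] say; the elements that can be added to [D] are then the
   [i]-largest one of [above i] and the [j]-largest one of [above j]. *)
Section Pivot.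
Variables (D : {set Z}) (m : I -> Z).
Hypothesis D_dom : dominant D.
Hypothesis m_in : forall k, m k \in D.
Hypothesis m_min : forall k b, b \in D -> r k (m k) <= r k b.

(** Dominance of [D] at such a [y] can only be witnessed by order [i], so [y] lies below all of [D]
    there. *)
Definition above i := [set y | [forall k, (k != i) ==> (r k (m k) < r k y)]].

Lemma aboveP i y :
  reflect (forall k, k != i -> r k (m k) < r k y) (y \in above i).
Proof.
rewrite inE; apply: (iffP forallP) => H k; last by apply/implyP/H.
by move=> ki; have /implyP := H k; apply.
Qed.

Definition top i := [set x in above i | [forall y in above i, r i y <= r i x]].

Lemma topP i x :
  reflect (x \in above i /\ forall y, y \in above i -> r i y <= r i x) (x \in top i).
Proof.
rewrite [x \in top i]inE; apply: (iffP andP) => -[-> H]; split => //.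
  exact/forall_inP.
exact/forall_inP.
Qed.

Lemma card_top i : #|top i| = (above i != set0).
Proof.
have [E|[x0 x0P]] := set_0Vmem (above i).
  rewrite E eqxx; apply/eqP; rewrite cards_eq0 -subset0; apply/subsetP => x.
  by case/topP; rewrite E.
have -> : above i != set0 by apply/set0Pn; exists x0.
have [x xP xmax] : exists2 x, x \in above i & forall y, y \in above i -> r i y <= r i x.
  by case: (arg_maxnP (r i) x0P) => x xP H; exists x.
apply/eqP/cards1P; exists x; apply/setP => y; rewrite inE.
apply/topP/eqP => [[yP ymax]|->] //.
by apply: (r_inj i); apply/eqP; rewrite eqn_leq xmax ?ymax.
Qed.

(** A common element would exceed the minimum of [D] in every order, against dominance of [D]. *)
Lemma disjoint_top i j : i != j -> [disjoint top i & top j].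
Proof.
move=> ij; rewrite disjoint_subset; apply/subsetP => x /topP[/aboveP xi _].
rewrite inE; apply/negP => /topP[/aboveP xj _].
have /dominantP/(_ x)[k /(_ _ (m_in k))] := D_dom.
rewrite leqNgt => /negP; apply.
by have [->|/xi//] := eqVneq k i; apply: xj.
Qed.

Section OneSide.
Variable i : I.
Hypothesis m_onto : forall z, z \in D -> exists2 k, k != i & m k = z.
Hypothesis m_inj : {in [set~ i] &, injective m}.

(** For [y] in [above i], order [i] works by maximality of [x]. Any other [y] is at most [m k] in
    some order [k] other than [i], and there [x] lies above [m k]. *)
Lemma top_dominant x : x \in top i -> x \notin D /\ dominant (x |: D).
Proof.
case/topP => /aboveP xa xmax; split.
  by apply/negP => /m_onto[k /xa]; move=> + E; rewrite E ltnn.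
apply/dominantP => y.
have [ya|] := boolP (y \in above i).
  exists i => b /setU1P[->|bD]; first exact: xmax.
  apply: leq_trans (xmax _ ya) _.
  have /dominantP/(_ x)[k Hk] := D_dom.
  have [<-|/xa] := eqVneq k i; first exact: Hk.
  by rewrite ltnNge Hk ?m_in.
rewrite inE negb_forall => /existsP[k]; rewrite negb_imply -leqNgt => /andP[ki yk].
exists k => b /setU1P[->|bD]; apply: leq_trans yk _; last exact: m_min.
exact/ltnW/xa.
Qed.

(** With [x] least in order [i], the order witnessing dominance at [m k] is not [i]. In it [m k] is
    least in [D], so injectivity of [m] away from [i] forces it to be [k], and [x] lies above
    [m k]. *)
Lemma dominant_top x : x \notin D -> dominant (x |: D) ->
  (forall b, b \in D -> r i x <= r i b) -> x \in top i.
Proof.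
move=> xD /dominantP dom xi.
have mx k : k != i -> r k (m k) < r k x.
  move=> ki; have [k' Hk'] := dom (m k).
  have mD := m_in k.
  have neq l : r l x != r l (m k).
    by apply: contraNneq xD => /r_inj->.
  have k'i : k' != i.
    apply: contraNneq xD => E; subst k'.
    have le1 := Hk' _ (setU11 x D); have le2 := xi _ mD.
    suff -> : x = m k by [].
    by apply: (r_inj i); apply/eqP; rewrite eqn_leq le1 le2.
  have E : m k' = m k.
    apply: (r_inj k'); apply/eqP.
    by rewrite eqn_leq m_min //= Hk' // setU1r ?m_in.
  have {}E : k' = k by apply: m_inj E; rewrite !inE.
  by subst k'; rewrite ltn_neqAle eq_sym neq Hk' ?setU11.
apply/topP; split; first exact/aboveP.
move=> y /aboveP ya; have [k Hk] := dom y.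
have [<-|/ya] := eqVneq k i; first by rewrite Hk ?setU11.
by rewrite ltnNge Hk // setU1r ?m_in.
Qed.
End OneSide.

(** Dominance makes [m] onto [D], and the size of [D] makes it injective once [i] or [j] is dropped.
    An added [x] is least in some order [k]; were [k] neither [i] nor [j], [m] would be onto and
    hence injective without [k], contradicting [m i = m j]. *)
Lemma card_pivots i j : i != j -> m i = m j -> #|D|.+1 = #|I| ->
  #|[set x | (x \notin D) && dominant (x |: D)]| =
    (above i != set0) + (above j != set0).
Proof.
move=> ij mij cD.
have onto0 z : z \in D -> exists k, m k = z.
  move=> zD; have /dominantP/(_ z)[k Hk] := D_dom; exists k.
  by apply: (r_inj k); apply/eqP; rewrite eqn_leq m_min // Hk ?m_in.
have ontoi z : z \in D -> exists2 k, k != i & m k = z.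
  move=> /onto0[k E]; have [ki|] := eqVneq k i; last by exists k.
  by exists j; rewrite 1?eq_sym // -mij -ki.
have ontoj z : z \in D -> exists2 k, k != j & m k = z.
  move=> /onto0[k E]; have [kj|] := eqVneq k j; last by exists k.
  by exists i; rewrite // mij -kj.
have inj l : (forall z, z \in D -> exists2 k, k != l & m k = z) ->
    {in [set~ l] &, injective m}.
  move=> onto; apply/imset_injP/eqP.
  rewrite -(eqP (_ : D == m @: [set~ l])) ?cardsC1 -?cD //.
  rewrite eqEsubset; apply/andP; split; apply/subsetP => z.
    by move/onto => [k kl <-]; apply: imset_f; rewrite !inE.
  by case/imsetP => k _ ->.
rewrite -!card_top -cardsUI; have /disjoint_setI0-> := disjoint_top _ _ ij.
rewrite cards0 addn0; congr #|pred_of_set _|; apply/setP => x; rewrite in_setU [LHS]inE.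
apply/andP/orP.
  case=> xD dom; have /dominantP/(_ x)[k Hk] := dom.
  have {}Hk b : b \in D -> r k x <= r k b by move=> bD; rewrite Hk ?setU1r.
  have [ki|ki] := eqVneq k i.
    by left; have := dominant_top _ (inj _ ontoi) x xD dom; apply; rewrite -ki.
  have [kj|kj] := eqVneq k j.
    by right; have := dominant_top _ (inj _ ontoj) x xD dom; apply; rewrite -kj.
  have ontok z : z \in D -> exists2 l, l != k & m l = z.
    move=> zD; have /dominantP/(_ z)[l Hl] := dom; exists l.
      apply: contraNneq xD => E; subst l.
      suff -> : x = z by [].
      by apply: (r_inj k); apply/eqP; rewrite eqn_leq Hk //= Hl ?setU11.
    by apply: (r_inj l); apply/eqP; rewrite eqn_leq m_min //= Hl // setU1r ?m_in.
  case/negP: ij; apply/eqP; apply: (inj _ ontok) => //; by rewrite !inE eq_sym.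
by case=> xt; [case: (top_dominant i ontoi x)|case: (top_dominant j ontoj x)].
Qed.
End Pivot.

(* [slack i] is the least element of order [i] and exceeds every non-slack element in all
   other orders; it plays the part of a facet, and a set containing [slack i] is one whose
   dominance does not use index [i]. *)
Section Coloring.
Variables (slack : I -> Z) (c : Z -> I) (x0 : Z).
Hypothesis slack_min : forall i y, y != slack i -> r i (slack i) < r i y.
Hypothesis slack_max :
  forall i j y, i != j -> (forall l, y != slack l) -> r i y < r i (slack j).
Hypothesis x0P : forall l, x0 != slack l.
Hypothesis c_slack : forall i, c (slack i) = i.
Variables i0 i1 : I.
Hypothesis i01 : i0 != i1.

Lemma imset_inj_in (T U : finType) (f : T -> U) (A : {set T}) (k : nat) :
  #|A| = k -> #|f @: A| = k -> {in A &, injective f}.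
Proof. by move=> <- /eqP /imset_injP. Qed.

Lemma slack_inj : injective slack.
Proof. exact: can_inj c_slack. Qed.

(** A dominant [D] other than the slack facet contains a non-slack element, so every [slack a] lies
    in [above m a] and there are two extensions. The slack facet has just one, and this single odd
    case drives the parity argument. *)
Lemma odd_pivots (D : {set Z}) :
  #|D|.+1 = #|I| -> c @: D = [set~ i0] ->
  odd #|[set x | (x \notin D) && dominant (x |: D)]| = (D == slack @: [set~ i0]).
Proof.
move=> cD colD.
have [D_dom|ndom] := boolP (dominant D); last first.
  have -> : [set x | (x \notin D) && dominant (x |: D)] = set0.
    apply/setP => x; rewrite !inE; apply: contraNF ndom => /andP[_].
    exact/dominant_sub/subsetUr.
  rewrite cards0; apply/esym/negbTE; apply: contraNneq ndom => ->.
  apply/dominantP => y; have [/existsP[l /eqP->]|] := boolP [exists l, y == slack l].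
    exists l => b _; have [->//|] := eqVneq b (slack l).
    by move/slack_min/ltnW.
  rewrite negb_exists => /forallP yn; exists i0 => b /imsetP[k]; rewrite !inE => ki ->.
  by apply/ltnW/slack_max; rewrite // eq_sym.
(* The second index [i1] makes [D] nonempty, so that minima exist. *)
have [d0 d0D] : exists d0, d0 \in D.
  have : i1 \in c @: D by rewrite colD !inE eq_sym.
  by case/imsetP => d dD _; exists d.
pose m k := [arg min_(x < d0 in D) r k x].
have m_in k : m k \in D by rewrite /m; case: arg_minnP.
have m_min k b : b \in D -> r k (m k) <= r k b.
  by rewrite /m; case: arg_minnP => // x _ H /H.
have m_eq k z : z \in D -> (forall b, b \in D -> r k z <= r k b) -> m k = z.
  move=> zD zmin; apply: (r_inj k); apply/eqP.
  by rewrite eqn_leq m_min //= zmin.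
have [E|DN] := eqVneq D (slack @: [set~ i0]); last first.
  have [i [j [ij mij]]] : exists i j, i != j /\ m i = m j.
    have : ~~ injectiveb m.
      apply/negP => /injectiveP minj.
      have : #|m @: [set: I]| <= #|D|.
        by apply/subset_leq_card/subsetP => z /imsetP[k _ ->].
      by rewrite card_imset // cardsT -cD ltnn.
    by move=> /injectivePn[i [j ij E]]; exists i, j.
  rewrite (card_pivots D m D_dom m_in m_min i j) //.
  have [y yD ys] : exists2 y, y \in D & forall l, y != slack l.
    have /existsP[y /andP[yD /forallP ys]] :
        [exists y, (y \in D) && [forall l, y != slack l]].
      apply: contraNT DN; rewrite negb_exists => /forallP H.
      rewrite eqEcard; apply/andP; split; last first.
        by rewrite (card_imset _ slack_inj) cardsC1 -cD.
      apply/subsetP => y yD; have := H y; rewrite yD /= negb_forall => /existsP[l].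
      rewrite negbK => /eqP Ey; rewrite Ey imset_f // -colD.
      by apply/imsetP; exists y; rewrite // Ey c_slack.
    by exists y.
  have slack_above a : above m a != set0.
    apply/set0Pn; exists (slack a); apply/aboveP => k ka.
    exact: leq_ltn_trans (m_min _ _ yD) (slack_max _ _ _ ka ys).
  by rewrite !slack_above.
have m_slack k : k != i0 -> m k = slack k.
  move=> ki; apply: m_eq; first by rewrite E imset_f // !inE.
  by move=> b _; have [->//|/slack_min/ltnW] := eqVneq b (slack k).
have [j ji mi0] : exists2 j, j != i0 & m i0 = slack j.
  by have := m_in i0; rewrite E => /imsetP[j]; rewrite !inE => ji ->; exists j.
rewrite (card_pivots D m D_dom m_in m_min i0 j) //; last 2 first.
- by rewrite eq_sym.
- by rewrite mi0 m_slack.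
have -> : above m i0 != set0.
  apply/set0Pn; exists x0; apply/aboveP => k ki.
  by rewrite m_slack ?slack_min ?x0P.
(* An element of [above m j] exceeds [slack j] in order [i0], hence is some [slack l] with [l]
   different from [j]; but [slack l] is least in order [l], which [above] forbids. *)
have /eqP -> : above m j == set0.
  rewrite -subset0; apply/subsetP => y /aboveP ya.
  have yi0 : r i0 (slack j) < r i0 y by rewrite -mi0 ya // eq_sym.
  have [/existsP[l /eqP El]|] := boolP [exists l, y == slack l]; last first.
    rewrite negb_exists => /forallP ys; have := slack_max i0 j y _ ys.
    by rewrite eq_sym ltnNge (ltnW yi0) => /(_ ji).
  have [lj|/ya] := eqVneq l j; first by rewrite El lj ltnn in yi0.
  have [->//|/slack_min/ltnW] := eqVneq (m l) (slack l); first by rewrite El ltnn.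
  by rewrite El leqNgt => /negbTE->.
by rewrite eqxx.
Qed.

(** If deleting [x] leaves each color but [i0] once, [x] does not have color [i0], as all colors
    would occur. Its color then recurs at exactly one [y], and [x], [y] are the only elements whose
    deletion does so. *)
Lemma even_facets (B : {set Z}) : #|B| = #|I| -> c @: B != setT ->
  ~~ odd #|[set x in B | c @: (B :\ x) == [set~ i0]]|.
Proof.
move=> cB colB; set S := [set x in B | _].
have [->|[x]] := set_0Vmem S; first by rewrite cards0.
rewrite inE => /andP[xB /eqP Ex].
have cardx z : z \in B -> #|B :\ z| = #|I|.-1 by move=> zB; rewrite -cB (cardsD1 z B) zB.
have injx : {in B :\ x &, injective c}.
  by apply: imset_inj_in (cardx x xB) _; rewrite Ex cardsC1.
have cx : c x != i0.
  apply: contraNneq colB => E; rewrite -(setD1K xB) imsetU1 Ex E.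
  by apply/eqP/setP => k; rewrite !inE; case: eqP.
have [y yBx Exy] : exists2 y, y \in B :\ x & c x = c y.
  by apply/imsetP; rewrite Ex !inE.
have [yx yB] := setD1P yBx.
suff -> : S = [set x; y] by rewrite cards2 eq_sym yx.
apply/setP => z; rewrite !inE; apply/andP/orP => [[zB /eqP Ez]|].
  have [->|zx] := eqVneq z x; [by left|right].
  apply/negPn/negP => zy.
  have : c z \in c @: (B :\ z).
    by rewrite Ez -Ex imset_f // !inE zx.
  case/imsetP => w; rewrite !inE => /andP[wz wB] E.
  have [wx|wx] := eqVneq w x.
    by case/eqP: zy; apply: injx; rewrite // ?inE ?zx // E wx.
  by case/eqP: wz; apply: injx; rewrite // !inE ?zx ?wx.
case=> /eqP ->; first by rewrite Ex.
split=> //; rewrite -Ex; apply/eqP/setP => k.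
apply/imsetP/imsetP => -[w /setD1P[wn wB] ->].
  have [wx|wx] := eqVneq w x; first by exists y; rewrite // wx.
  by exists w; rewrite // !inE wx.
have [wy|wy] := eqVneq w y; first by exists x; rewrite ?wy // !inE eq_sym yx.
by exists w; rewrite // !inE wy.
Qed.

Lemma odd_card (T : finType) (A : {set T}) : odd #|A| = \big[addb/false]_(x in A) true.
Proof. by rewrite -sum1_card (big_morph odd oddD erefl). Qed.

Lemma scarf : exists B : {set Z}, [/\ dominant B, #|B| = #|I| & c @: B = setT].
Proof.
have [/existsP[B /and3P[Bd /eqP cB /eqP EB]]|] :=
    boolP [exists B : {set Z}, [&& dominant B, #|B| == #|I| & c @: B == setT]].
  by exists B.
rewrite negb_exists => /forallP noB; exfalso.
(* Incidences between a set [B] and its facet [D = B :\ x]: [P] describes them from [B], [Q] from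
   [D]. Their parity is computed both ways. *)
pose P (B : {set Z}) x := [&& x \in B, dominant B, #|B| == #|I| &
  c @: (B :\ x) == [set~ i0]].
pose Q (D : {set Z}) x := [&& x \notin D, dominant (x |: D), #|D|.+1 == #|I| &
  c @: D == [set~ i0]].
have E1 : \big[addb/false]_(B : {set Z}) \big[addb/false]_(x | P B x) true = false.
  apply: big1 => B _; have := noB B; rewrite /P.
  have [_|_ _] := boolP (dominant B); last by rewrite big_pred0 // => x; rewrite andbF.
  have [cB|_ _] := eqVneq #|B| #|I|; last by rewrite big_pred0 // => x; rewrite andbF.
  move=> /= /even_facets - /(_ cB) /negbTE; rewrite odd_card => H; rewrite -[RHS]H.
  by apply: eq_bigl => x; rewrite inE.
have E2 : \big[addb/false]_(D : {set Z}) \big[addb/false]_(x | Q D x) true = true.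
  rewrite (bigD1 (slack @: [set~ i0])) //= [X in _ (+) X]big1 => [|D Dn].
    have cD : #|slack @: [set~ i0]|.+1 = #|I|.
      rewrite (card_imset _ slack_inj) cardsC1 prednK //.
      by apply/card_gt0P; exists i0.
    have EcD : c @: (slack @: [set~ i0]) = [set~ i0].
      by rewrite -imset_comp (eq_imset _ c_slack) imset_id.
    have := odd_pivots _ cD EcD; rewrite eqxx odd_card => H; rewrite addbF -[RHS]H.
    by apply: eq_bigl => x; rewrite inE /Q cD EcD !eqxx !andbT.
  have [cD|cD] := eqVneq #|D|.+1 #|I|; last first.
    by rewrite big_pred0 // => x; rewrite /Q (negbTE cD) !andbF.
  have [EcD|EcD] := eqVneq (c @: D) [set~ i0]; last first.
    by rewrite big_pred0 // => x; rewrite /Q (negbTE EcD) !andbF.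
  have := odd_pivots _ cD EcD; rewrite (negbTE Dn) odd_card => H; rewrite -[RHS]H.
  by apply: eq_bigl => x; rewrite inE /Q cD EcD !eqxx !andbT.
suff E3 : \big[addb/false]_B \big[addb/false]_(x | P B x) true =
    \big[addb/false]_D \big[addb/false]_(x | Q D x) true by rewrite E1 E2 in E3.
rewrite (exchange_big_dep xpredT) //= [RHS](exchange_big_dep xpredT) //=.
apply: eq_bigr => x _.
rewrite (reindex_onto (fun D => x |: D) (fun B => B :\ x)) /=; last first.
  by move=> B /and4P[xB _ _ _]; rewrite setD1K.
apply: eq_bigl => D; rewrite /P /Q setU11 /=.
have [xD|xD] := boolP (x \in D).
  rewrite /= [(_ |: _) :\ _ == _](_ : _ = false) ?andbF //.
  by apply/eqP => E; have := setD11 x (x |: D); rewrite E xD.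
by rewrite setU1K // eqxx andbT cardsU1 xD.
Qed.

End Coloring.
End Scarf.

(** * Lattice points of a simplex as partitions of an integer *)

Section Grid.
Variables n N : nat.

(** The coordinates are the piece lengths of a partition of [N]; the form [n.+2] provides the two
    distinct indices required by [scarf]. *)
Definition grid := {x : {ffun 'I_n.+2 -> 'I_N.+1} | \sum_i x i == N}.

Lemma grid_sum (x : grid) : \sum_i val x i = N.
Proof. exact/eqP/(valP x). Qed.

Lemma grid_of (f : 'I_n.+2 -> nat) :
  \sum_i f i = N -> exists x : grid, forall i, val x i = f i :> nat.
Proof.
move=> fN.
have ford i : f i < N.+1 by rewrite ltnS -fN (bigD1 i) //= leq_addr.
have xP : \sum_i [ffun i => Ordinal (ford i)] i == N.
  by rewrite -[X in _ == X]fN; apply/eqP/eq_bigr => i _; rewrite ffunE.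
exists (exist (fun x : {ffun 'I_n.+2 -> 'I_N.+1} => \sum_i x i == N) _ xP) => i.
by rewrite ffunE.
Qed.

(* Order [i] compares [i]-th coordinates, ties being broken by [enum_rank]. *)
Definition grid_rank (i : 'I_n.+2) (z : grid + 'I_n.+2) : nat :=
  match z with
  | inl x => (val x i * #|{: grid}| + enum_rank x).+1
  | inr j => if j == i then 0 else N.+1 * #|{: grid}| + j.+1
  end.

Lemma grid_rank_lt i (x : grid) : grid_rank i (inl x) < N.+1 * #|{: grid}| + 1.
Proof.
rewrite /= addn1 ltnS -addnS.
apply: leq_trans (_ : (val x i).+1 * #|{: grid}| <= _).
  by rewrite mulSn addnC leq_add2r ltn_ord.
by rewrite leq_mul2r ltn_ord orbT.
Qed.

Lemma grid_rank_le i (x y : grid) :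
  grid_rank i (inl x) <= grid_rank i (inl y) -> val x i <= val y i.
Proof.
rewrite /= ltnS => /(leq_div2r #|{: grid}|).
have K : 0 < #|{: grid}| by apply/card_gt0P; exists x.
by rewrite !divnMDl // !divn_small ?ltn_ord // !addn0.
Qed.

Lemma grid_rank_inj i : injective (grid_rank i).
Proof.
have sep (x : grid) j : grid_rank i (inl x) != grid_rank i (inr j).
  have := grid_rank_lt i x; have : 0 < grid_rank i (inl x) by [].
  case: (grid_rank i (inl x)) => // k _ kN /=; case: (j == i) => //.
  by rewrite neq_ltn (leq_trans kN) // leq_add2l.
move=> [x|j] [y|k] E.
- have K : 0 < #|{: grid}| by apply/card_gt0P; exists x.
  move: E => /= [] /(congr1 (modn ^~ #|{: grid}|)).
  by rewrite !modnMDl !modn_small ?ltn_ord // => /ord_inj/enum_rank_inj->.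
- by have := sep x k; rewrite E eqxx.
- by have := sep y j; rewrite E eqxx.
- move: E => /=; case: eqP => [->|_]; case: eqP => [->|_] //.
  + by rewrite addnS.
  + by rewrite addnS.
  by move/addnI => [] /ord_inj ->.
Qed.

(** Scarf's lemma gives a fully colored dominant set [B]. Its lattice points are close together,
    since a lattice point strictly above all coordinate minima would violate dominance. Where [B]
    contains the slack element of [i], the minimum counts as [0] and the [i]-th coordinate is
    small. *)
Lemma grid_sperner (P : 'I_n.+2 -> grid -> Prop) :
  (forall x, exists i, P i x) ->
  exists x : grid, forall i, val x i <= n.+2 \/ exists2 y : grid, P i y &
    forall j, (val x j <= val y j + n.+2) && (val y j <= val x j + n.+2).
Proof.
case/fin_all_exists => color colorP.
have [g0 _] : exists x : grid, forall i, val x i = (if i == ord0 then N else 0) :> nat.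
  apply: grid_of; rewrite (bigD1 ord0) //= big1 ?addn0 //.
  by move=> i /negbTE->.
pose c (z : grid + 'I_n.+2) := match z with inl x => color x | inr i => i end.
have [|||||B [/dominantP B_dom cB colB]] :=
    @scarf _ _ grid_rank grid_rank_inj inr c (inl g0) _ _ _ _ ord0 ord_max _ => //.
- move=> i [x|j] ji; rewrite /= eqxx //.
  by have [E|] := eqVneq j i; [rewrite E eqxx in ji|rewrite addnS].
- move=> i j [x|k] ij H; last by have := H k; rewrite eqxx.
  apply: leq_trans (grid_rank_lt i x) _.
  by rewrite /= eq_sym (negbTE ij) leq_add2l.
have colored i : inr i \notin B -> exists2 x : grid, inl x \in B & P i x.
  move=> iB; have : i \in c @: B by rewrite colB.
  case/imsetP => -[x|j] bB /= E; first by exists x => //; rewrite E.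
  by case/negP: iB; rewrite E.
have undominated (y : grid) : exists2 i, inr i \notin B & forall x : grid, inl x \in B -> val y i <= val x i.
  have [i Hi] := B_dom (inl y); exists i; last by move=> x /Hi /grid_rank_le.
  by apply/negP => /Hi /=; rewrite eqxx.
have [x xB] : exists x : grid, inl x \in B.
  by have [i /colored[x xB _] _] := undominated g0; exists x.
pose m i := if inr i \in B then 0 else val [arg min_(y < x | inl y \in B) val y i] i : nat.
have m_le (y : grid) i : inl y \in B -> m i <= val y i.
  by move=> yB; rewrite /m; case: ifP => // _; case: arg_minnP => // z _ ->.
have m_sum : N < \sum_i m i + n.+2.
  rewrite ltnNge; apply/negP => mN.
  (* Every coordinate exceeds [m i], and the surplus goes to [ord0] to make the sum [N]. *)
  have [|y Hy] := grid_of (fun i => (m i).+1 + if i == ord0 then N - (\sum_i m i + n.+2) else 0).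
    rewrite big_split /= -big_mkcond big_pred1_eq.
    under eq_bigr => i _ do rewrite -addn1.
    by rewrite big_split /= sum1_card card_ord subnKC.
  have [i iB yi] := undominated y.
  have : m i < val y i by rewrite Hy leq_addr.
  rewrite ltnNge => /negP; apply; rewrite /m (negbTE iB).
  by case: arg_minnP => // z zB _; apply: yi.
(* All coordinates are at least the minima and add up to [N], so none exceeds its minimum by more
   than the total deficit, which is below [n.+2]. *)
have le_m (y : grid) i : inl y \in B -> val y i <= m i + n.+2.
  move=> yB; rewrite -(leq_add2r (\sum_(j | j != i) m j)).
  have := ltnW m_sum; rewrite (bigD1 i) //= addnAC; apply: leq_trans.
  rewrite -[leqRHS](grid_sum y) [leqRHS](bigD1 i) //=.
  by rewrite leq_add2l; apply: leq_sum => j _; apply: m_le.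
exists x => i; have [iB|/colored[y yB Py]] := boolP (inr i \in B).
  by left; have := le_m x i xB; rewrite /m iB.
right; exists y => // j.
by rewrite !(leq_trans (le_m _ j _)) ?leq_add2r ?m_le.
Qed.

Definition grid_partition (x : grid) (k : nat) : nat := \sum_(j < n.+2 | j < k) val x j.

Lemma grid_partitionS (x : grid) (i : 'I_n.+2) :
  grid_partition x i.+1 = grid_partition x i + val x i.
Proof.
rewrite /grid_partition (bigD1 i) //= addnC; congr (_ + _).
by apply: eq_bigl => j; rewrite ltnS ltn_neqAle andbC.
Qed.

Lemma grid_partitionP (x : grid) : partition_to n.+2 N (grid_partition x).
Proof.
split; first by rewrite /grid_partition big_pred0.
split.
  by rewrite -[RHS](grid_sum x); apply: eq_bigl => j; apply: ltn_ord.
move=> i /ltP ilt; apply/leP.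
by rewrite (grid_partitionS x (Ordinal ilt)) leq_addr.
Qed.

(** A breakpoint sums at most [n.+2] piece lengths, whence the square. *)
Lemma grid_partition_close (x y : grid) k :
  (forall j, val x j <= val y j + n.+2) ->
  grid_partition x k <= grid_partition y k + n.+2 * n.+2.
Proof.
move=> xy; rewrite /grid_partition.
apply: leq_trans (_ : \sum_(j < n.+2 | j < k) (val y j + n.+2) <= _).
  by apply: leq_sum => j _; apply: xy.
rewrite big_split leq_add2l sum_nat_const leq_mul2r /=.
by rewrite -[X in _ <= X]card_ord max_card.
Qed.

Lemma partition_sperner (P : nat -> (nat -> nat) -> Prop) :
  (forall s, partition_to n.+2 N s -> exists i, (i < n.+2)%coq_nat /\ P i s) ->
  exists s, partition_to n.+2 N s /\
    forall i, (i < n.+2)%coq_nat -> (s i.+1 <= s i + n.+2)%coq_nat \/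
      exists t, [/\ partition_to n.+2 N t, P i t &
        forall j, (s j <= t j + n.+2 * n.+2)%coq_nat /\
          (t j <= s j + n.+2 * n.+2)%coq_nat].
Proof.
move=> cover.
have [|x Hx] := @grid_sperner (fun i x => P i (grid_partition x)).
  move=> x; have [i [/ltP ilt Pi]] := cover _ (grid_partitionP x).
  by exists (Ordinal ilt).
exists (grid_partition x); split; first exact: grid_partitionP.
move=> i /ltP ilt; have [small|[y Py xy]] := Hx (Ordinal ilt); [left|right].
  by apply/leP; rewrite (grid_partitionS x (Ordinal ilt)) leq_add2l.
exists (grid_partition y); split=> //; first exact: grid_partitionP.
by move=> j; split; apply/leP/grid_partition_close => l; have /andP[] := xy l.
Qed.
End Grid.
End Combinatorics.

(** * A covering theorem for partitions of an interval *)

Definition partition (T : R) (n : nat) (s : nat -> R) : Prop :=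
  s 0%nat = 0 /\ s n = T /\ forall i, (i < n)%nat -> s i <= s (S i).

Lemma partition_incr (T : R) (n : nat) (s : nat -> R) (i j : nat) :
  partition T n s -> (i <= j <= n)%nat -> s i <= s j.
Proof.
  intros [_ [_ H]] [Hij Hjn]. induction Hij as [|j Hij IH]; [lra|].
  apply Rle_trans with (s j); [apply IH; lia|apply H; lia].
Qed.

Lemma partition_bounds (T : R) (n : nat) (s : nat -> R) (j : nat) :
  partition T n s -> (j <= n)%nat -> 0 <= s j <= T.
Proof.
  intros H Hj. pose proof H as [H0 [Hn _]].
  rewrite <- H0 at 1. rewrite <- Hn.
  split; apply (partition_incr T n); auto with arith.
Qed.

(** The point [x] is the upper limit of [u n] as [e] tends to [0]: the supremum of the values that
    some [u n] reaches for every [e]. *)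
Lemma cluster_coordinate (Q : R -> (nat -> R) -> Prop) (a b : R) (n : nat) :
  (forall e e' u, e <= e' -> Q e u -> Q e' u) ->
  (forall e, 0 < e -> exists u, Q e u) ->
  (forall e u, Q e u -> a <= u n <= b) ->
  exists x, forall e, 0 < e -> exists u, Q e u /\ Rabs (u n - x) < e.
Proof.
  intros Qmono Qex Qb.
  destruct (completeness (fun x => forall e, 0 < e -> exists u, Q e u /\ x <= u n))
    as [x [xub xlub]].
  - exists b. intros y Hy. destruct (Hy 1 Rlt_0_1) as [u [Hu Hyu]].
    specialize (Qb _ _ Hu). lra.
  - exists a. intros e He. destruct (Qex e He) as [u Hu].
    exists u. split; [exact Hu|apply (Qb _ _ Hu)].
  - exists x. intros e He.
    assert (H1 : exists y, x - e < y /\ forall e', 0 < e' -> exists u, Q e' u /\ y <= u n).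
    { apply NNPP. intros Hn. assert (x <= x - e); [|lra].
      apply xlub. intros y Hy. apply Rnot_lt_le. intros Hlt. apply Hn. exists y. tauto. }
    destruct H1 as [y [Hy1 Hy2]].
    assert (H2 : exists e0, 0 < e0 /\ forall u, Q e0 u -> u n < x + e).
    { apply NNPP. intros Hn. assert (x + e <= x); [|lra].
      apply xub. intros e0 He0. apply NNPP. intros Hn'. apply Hn. exists e0.
      split; [exact He0|]. intros u Hu. apply Rnot_le_lt. intros Hle.
      apply Hn'. exists u. tauto. }
    destruct H2 as [e0 [He0 H2]].
    destruct (Hy2 (Rmin e e0)) as [u [Hu1 Hu2]]; [apply Rmin_pos; lra|].
    exists u. split; [apply Qmono with (2 := Hu1), Rmin_l|].
    apply Rabs_def1; [|lra].
    assert (u n < x + e); [|lra].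
    apply H2, Qmono with (2 := Hu1), Rmin_r.
Qed.

(** Bolzano-Weierstrass without sequences, one coordinate at a time: closeness in the earlier
    coordinates is absorbed into [Q], which stays monotone in [e]. *)
Lemma cluster_point (Q : R -> (nat -> R) -> Prop) (T : R) (n : nat) :
  (forall e e' u, e <= e' -> Q e u -> Q e' u) ->
  (forall e, 0 < e -> exists u, Q e u) ->
  (forall e u j, Q e u -> (j < n)%nat -> 0 <= u j <= T) ->
  exists l, forall e, 0 < e ->
    exists u, Q e u /\ forall j, (j < n)%nat -> Rabs (u j - l j) < e.
Proof.
  intros Qmono Qex. induction n as [|n IH]; intros Qb.
  - exists (fun _ => 0). intros e He. destruct (Qex e He) as [u Hu].
    exists u. split; [exact Hu|intros; lia].
  - destruct IH as [l Hl]; [intros; apply (Qb e); auto|].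
    destruct (cluster_coordinate
      (fun e u => Q e u /\ forall j, (j < n)%nat -> Rabs (u j - l j) < e) 0 T n)
      as [x Hx].
    + intros e e' u Hee [H1 H2]. split; [now apply Qmono with e|].
      intros j Hj. specialize (H2 j Hj). lra.
    + exact Hl.
    + intros e u [H _]. apply (Qb e); auto.
    + exists (fun j => if Nat.eq_dec j n then x else l j). intros e He.
      destruct (Hx e He) as [u [[H1 H2] H3]]. exists u. split; [exact H1|].
      intros j Hj. destruct (Nat.eq_dec j n) as [->|Hne]; [exact H3|apply H2; lia].
Qed.

Lemma scaled_partition (T : R) (n N : nat) (s : nat -> nat) :
  0 < T -> (0 < N)%nat -> partition_to n N s ->
  partition T n (fun j => T / INR N * INR (s j)).
Proof.
  intros HT HN [H0 [Hn Hs]]. assert (0 < INR N) by now apply lt_0_INR.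
  split; [rewrite H0; simpl; ring|]. split; [rewrite Hn; field; lra|].
  intros i Hi. apply Rmult_le_compat_l.
  - apply Rlt_le, Rdiv_lt_0_compat; lra.
  - apply le_INR, Hs, Hi.
Qed.

(** The conclusion of the covering theorem up to an error [e], in the monotone form that
    [cluster_point] takes. *)
Definition almost_covered (T : R) (n : nat) (K : nat -> (nat -> R) -> Prop)
    (e : R) (s : nat -> R) : Prop :=
  partition T n s /\
  forall i, (i < n)%nat -> s (S i) <= s i + e \/
    exists t, partition T n t /\ K i t /\
      forall j, (j <= n)%nat -> Rabs (t j - s j) <= e.

Lemma exists_almost_covered (T : R) (n : nat) (K : nat -> (nat -> R) -> Prop) (e : R) :
  0 < T -> (2 <= n)%nat -> 0 < e ->
  (forall s, partition T n s -> exists i, (i < n)%nat /\ K i s) ->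
  exists s, almost_covered T n K e s.
Proof.
  intros HT Hn He Hcov.
  destruct n as [|[|n]]; [lia|lia|]. set (m := S (S n)) in *.
  assert (Hm : 1 <= INR m) by (apply (le_INR 1); lia).
  (* Discrete partitions agree up to [m * m] steps of the mesh [T / N], which must amount to at most
     [e]. *)
  destruct (INR_unbounded (T * (INR m * INR m) / e)) as [N HN].
  assert (HN0 : 0 < INR N).
  { apply Rle_lt_trans with (2 := HN). apply Rlt_le, Rdiv_lt_0_compat; [|exact He].
    repeat apply Rmult_lt_0_compat; lra. }
  assert (HNn : (0 < N)%nat) by now apply INR_lt.
  set (c := T / INR N).
  assert (Hc : 0 < c) by (apply Rdiv_lt_0_compat; lra).
  assert (Hce : c * (INR m * INR m) <= e).
  { unfold c. apply Rmult_lt_compat_r with (r := e) in HN; [|lra].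
    unfold Rdiv in HN. rewrite Rmult_assoc, Rinv_l, Rmult_1_r in HN; [|lra].
    apply Rmult_le_reg_r with (INR N); [lra|].
    replace (T / INR N * (INR m * INR m) * INR N) with (T * (INR m * INR m)) by (field; lra).
    lra. }
  assert (Hcm : c * INR m <= e).
  { apply Rle_trans with (2 := Hce), Rmult_le_compat_l; [lra|].
    rewrite <- (Rmult_1_l (INR m)) at 1. apply Rmult_le_compat_r; lra. }
  destruct (Combinatorics.partition_sperner n N
    (fun i s => K i (fun j => c * INR (s j)))) as [s [Hs H]].
  - intros s Hs. apply Hcov. now apply scaled_partition.
  - exists (fun j => c * INR (s j)). split; [now apply scaled_partition|].
    intros i Hi. destruct (H i Hi) as [H1|[t [Ht HK Hst]]]; [left|right].
    + apply le_INR in H1. change (INR (s (S i)) <= INR (s i + m)) in H1.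
      rewrite plus_INR in H1. apply (Rmult_le_compat_l c) in H1; [lra|lra].
    + exists (fun j => c * INR (t j)).
      split; [now apply scaled_partition|]. split; [exact HK|].
      intros j _. destruct (Hst j) as [Ha Hb].
      apply le_INR in Ha, Hb.
      change (INR (s j) <= INR (t j + m * m)) in Ha.
      change (INR (t j) <= INR (s j + m * m)) in Hb.
      rewrite plus_INR, mult_INR in Ha, Hb.
      apply (Rmult_le_compat_l c) in Ha; [|lra]. apply (Rmult_le_compat_l c) in Hb; [|lra].
      apply Rabs_le. lra.
Qed.

(** A cluster point [l] of almost covered partitions works: if [K i] fails at [l], closedness keeps
    a neighborhood of [l] free of [K i], so nearby partitions have a short [i]-th piece, whose
    length tends to [0]. *)
Lemma partition_kkm (T : R) (n : nat) (K : nat -> (nat -> R) -> Prop) :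
  0 < T -> (2 <= n)%nat ->
  (forall i l, (i < n)%nat ->
     (forall e, 0 < e -> exists u, partition T n u /\ K i u /\
        forall j, (j <= n)%nat -> Rabs (u j - l j) < e) -> K i l) ->
  (forall s, partition T n s -> exists i, (i < n)%nat /\ K i s) ->
  exists s, partition T n s /\ forall i, (i < n)%nat -> s (S i) = s i \/ K i s.
Proof.
  intros HT Hn Hclosed Hcov.
  destruct (cluster_point (almost_covered T n K) T (S n)) as [l Hl].
  - intros e e' u Hee [Hu H]. split; [exact Hu|]. intros i Hi.
    destruct (H i Hi) as [H1|[t [Ht [HK Hd]]]]; [left; lra|right].
    exists t. repeat split; try apply Ht; try exact HK.
    intros j Hj. specialize (Hd j Hj). lra.
  - intros e He. now apply exists_almost_covered.
  - intros e u j [Hu _] Hj. apply (partition_bounds T n); [exact Hu|lia].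
  - assert (Hlim : forall j, (j < S n)%nat -> forall x,
      (forall e u, 0 < e -> partition T n u -> Rabs (u j - l j) < e -> Rabs (x - l j) <= e) ->
      x = l j).
    { intros j Hj x Hx. apply Rminus_diag_uniq. apply NNPP. intros Hne.
      apply Rabs_pos_lt in Hne. destruct (Hl (Rabs (x - l j) / 2)) as [u [[Hu _] Hd]]; [lra|].
      specialize (Hx (Rabs (x - l j) / 2) u ltac:(lra) Hu (Hd j Hj)). lra. }
    assert (Hstep : forall i, (i < n)%nat -> l i <= l (S i)).
    { intros i Hi. apply Rnot_lt_le. intros Hlt.
      destruct (Hl ((l i - l (S i)) / 2)) as [u [[[_ [_ Hu]] _] Hd]]; [lra|].
      destruct (Rabs_def2 _ _ (Hd i ltac:(lia))).
      destruct (Rabs_def2 _ _ (Hd (S i) ltac:(lia))).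
      specialize (Hu i Hi). lra. }
    assert (Hpart : partition T n l).
    { split; [|split; [|exact Hstep]]; symmetry; apply Hlim; try lia.
      - intros e u _ [H0 _]. rewrite H0. lra.
      - intros e u _ [_ [H0 _]]. rewrite H0. lra. }
    exists l. split; [exact Hpart|]. intros i Hi.
    destruct (classic (K i l)) as [HK|HK]; [now right|left].
    assert (Hfar : exists e0, 0 < e0 /\ forall u, partition T n u -> K i u ->
      ~ forall j, (j <= n)%nat -> Rabs (u j - l j) < e0).
    { apply NNPP. intros Hno. apply HK, Hclosed; [exact Hi|]. intros e He.
      apply NNPP. intros Hno'. apply Hno. exists e. split; [exact He|].
      intros u Hu HKu Hd. apply Hno'. exists u. tauto. }
    destruct Hfar as [e0 [He0 Hfar]].
    apply Rle_antisym; [|now apply Hstep].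
    apply Rnot_lt_le. intros Hlt. set (d := l (S i) - l i) in *.
    assert (Hd0 : 0 < d) by (unfold d; lra).
    (* [e0 / 2] leaves room for the second error, between [u] and [t]; with [d / 3], a short piece
       of [u] would make the piece of [l] shorter than [d]. *)
    destruct (Hl (Rmin (e0 / 2) (d / 3))) as [u [[Hu Hcase] Hd]]; [apply Rmin_pos; lra|].
    pose proof (Rmin_l (e0 / 2) (d / 3)). pose proof (Rmin_r (e0 / 2) (d / 3)).
    destruct (Hcase i Hi) as [H1|[t [Ht [HKt Htd]]]].
    + destruct (Rabs_def2 _ _ (Hd i ltac:(lia))).
      destruct (Rabs_def2 _ _ (Hd (S i) ltac:(lia))).
      unfold d in *. lra.
    + apply (Hfar t Ht HKt). intros j Hj. specialize (Htd j Hj).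
      specialize (Hd j ltac:(lia)).
      replace (t j - l j) with ((t j - u j) + (u j - l j)) by ring.
      apply Rle_lt_trans with (1 := Rabs_triang _ _). lra.
Qed.

(** * The tangent cone of the curve at the base point *)

Lemma pdist_nonneg (p q : R * R) : 0 <= pdist p q.
Proof. apply sqrt_pos. Qed.

Lemma pdist_sym (p q : R * R) : pdist p q = pdist q p.
Proof. unfold pdist. f_equal. ring. Qed.

Lemma pdist_refl (p : R * R) : pdist p p = 0.
Proof. unfold pdist. rewrite !Rminus_diag. simpl. rewrite Rmult_0_l, Rplus_0_l. apply sqrt_0. Qed.

Lemma pdist_eq0 (p q : R * R) : pdist p q = 0 -> p = q.
Proof.
  unfold pdist. intros H.
  apply sqrt_eq_0 in H; [|apply Rplus_le_le_0_compat; apply pow2_ge_0].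
  rewrite <- !Rsqr_pow2 in H. apply Rplus_sqr_eq_0 in H as [H1 H2].
  apply injective_projections; lra.
Qed.

(** Cauchy-Schwarz against a unit vector, from Lagrange's identity. *)
Lemma dot_le_pdist (p q : R * R) (vx vy : R) :
  vx ^ 2 + vy ^ 2 = 1 ->
  (fst p - fst q) * vx + (snd p - snd q) * vy <= pdist p q.
Proof.
  intros Hv. unfold pdist. set (x := fst p - fst q). set (y := snd p - snd q).
  apply Rle_trans with (1 := Rle_abs _). rewrite <- sqrt_Rsqr_abs.
  apply sqrt_le_1_alt. unfold Rsqr.
  replace (x ^ 2 + y ^ 2) with ((x ^ 2 + y ^ 2) * (vx ^ 2 + vy ^ 2)) by (rewrite Hv; ring).
  pose proof (pow2_ge_0 (x * vy - y * vx)). nra.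
Qed.

Lemma continuity_pt_eps (f : R -> R) (x : R) :
  continuity_pt f x <->
  forall e, 0 < e -> exists d, 0 < d /\ forall y, Rabs (y - x) < d -> Rabs (f y - f x) < e.
Proof.
  split.
  - intros H e He. destruct (H e He) as [d [Hd Hf]]. exists d. split; [exact Hd|].
    intros y Hy. destruct (Req_dec y x) as [->|Hne].
    + rewrite Rminus_diag, Rabs_R0. exact He.
    + apply Hf. repeat split; auto.
  - intros H e He. destruct (H e He) as [d [Hd Hf]]. exists d. split; [exact Hd|].
    intros y [_ Hy]. now apply Hf.
Qed.

Lemma IVT_zero (f : R -> R) (a b : R) :
  a <= b -> (forall x, a <= x <= b -> continuity_pt f x) -> f a * f b <= 0 ->
  exists x, a <= x <= b /\ f x = 0.
Proof.
  intros Hab Hc Hs.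
  destruct (Req_dec (f a) 0) as [Ha|Ha]; [exists a; split; [lra|exact Ha]|].
  destruct (Req_dec (f b) 0) as [Hb|Hb]; [exists b; split; [lra|exact Hb]|].
  destruct Hab as [Hab|Hab]; [|subst b; nra].
  destruct (Rtotal_order (f a) 0) as [Hfa|[Hfa|Hfa]]; [|tauto|].
  - destruct (Ranalysis5.IVT_interv f a b Hc Hab Hfa) as [x Hx]; [nra|eauto].
  - destruct (Ranalysis5.IVT_interv (fun x => - f x) a b) as [x [Hx1 Hx2]]; try nra.
    + intros x Hx. apply continuity_pt_opp. now apply Hc.
    + exists x. split; [exact Hx1|lra].
Qed.

Lemma segment_between (a b u v t : R) :
  a < u < b -> a < v < b -> 0 <= t <= 1 -> a < u + t * (v - u) < b.
Proof. intros Hu Hv Ht. destruct (Rle_dec u v); split; nra. Qed.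

(* For [x1 < y1] and [x2 < y2] the pairs [(x1, y1)] and [(x2, y2)] are joined by a
   segment of such pairs, along which [f y - f x] never vanishes. *)
Lemma continuous_injective_monotone (f : R -> R) (a b : R) :
  (forall x, a < x < b -> continuity_pt f x) ->
  (forall x y, a < x < b -> a < y < b -> f x = f y -> x = y) ->
  (forall x y, a < x -> x < y -> y < b -> f x < f y) \/
  (forall x y, a < x -> x < y -> y < b -> f y < f x).
Proof.
  intros Hc Hinj.
  assert (Hsame : forall x1 y1 x2 y2, a < x1 -> x1 < y1 -> y1 < b ->
    a < x2 -> x2 < y2 -> y2 < b -> 0 < (f y1 - f x1) * (f y2 - f x2)).
  { intros x1 y1 x2 y2 H1 H2 H3 H4 H5 H6. apply Rnot_le_lt. intros Hle.
    destruct (IVT_zero (fun t => f (y1 + t * (y2 - y1)) - f (x1 + t * (x2 - x1))) 0 1)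
      as [t [Ht Hz]].
    - lra.
    - intros t Ht.
      assert (Hcomp : forall u v, a < u < b -> a < v < b ->
        continuity_pt (fun t => f (u + t * (v - u))) t).
      { intros u v Hu Hv.
        apply (continuity_pt_comp (fun t => u + t * (v - u)) f).
        - apply derivable_continuous_pt. reg.
        - apply Hc, segment_between; assumption. }
      apply continuity_pt_minus; apply Hcomp; lra.
    - simpl. rewrite !Rmult_0_l, !Rmult_1_l, !Rplus_0_r.
      replace (y1 + (y2 - y1)) with y2 by ring. replace (x1 + (x2 - x1)) with x2 by ring.
      exact Hle.
    - apply Rminus_diag_uniq, Hinj in Hz; try (apply segment_between; lra).
      destruct (segment_between 0 (y1 - x1 + y2 - x2) (y1 - x1) (y2 - x2) t); lra. }
  destruct (classic (exists x y, a < x /\ x < y /\ y < b /\ f x < f y))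
    as [[x1 [y1 [H1 [H2 [H3 H4]]]]]|Hno]; [left|right]; intros x y Hx Hxy Hy.
  - specialize (Hsame x1 y1 x y H1 H2 H3 Hx Hxy Hy). nra.
  - apply Rnot_le_lt. intros [Hlt|Heq].
    + apply Hno. now exists x, y.
    + apply Hinj in Heq; lra.
Qed.

Lemma increasing_onto_nbhd (f : R -> R) (a b t0 : R) :
  a < t0 < b -> (forall x, a < x < b -> continuity_pt f x) ->
  (forall x y, a < x -> x < y -> y < b -> f x < f y) ->
  exists d, 0 < d /\ forall s, f t0 - d <= s <= f t0 + d -> exists t, a < t < b /\ f t = s.
Proof.
  intros Ht Hc Hincr. set (l := (a + t0) / 2). set (r := (t0 + b) / 2).
  assert (a < l < t0) by (unfold l; lra). assert (t0 < r < b) by (unfold r; lra).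
  pose proof (Hincr l t0 ltac:(lra) ltac:(lra) ltac:(lra)).
  pose proof (Hincr t0 r ltac:(lra) ltac:(lra) ltac:(lra)).
  exists (Rmin (f t0 - f l) (f r - f t0)). split; [apply Rmin_pos; lra|].
  intros s Hs. pose proof (Rmin_l (f t0 - f l) (f r - f t0)).
  pose proof (Rmin_r (f t0 - f l) (f r - f t0)).
  destruct (IVT_zero (fun t => f t - s) l r) as [t [Ht1 Ht2]].
  - lra.
  - intros t Ht1. apply continuity_pt_minus; [apply Hc; lra|].
    now apply continuity_pt_const.
  - nra.
  - exists t. split; lra.
Qed.

(** * Injectivity and continuous inverse of the parametrization *)

Section Jordan.
Variable gamma : R -> R * R.
Hypothesis gamma_jordan : jordan_param gamma.

Lemma gamma_shift (k : Z) (s : R) : gamma (s + IZR k * (2 * PI)) = gamma s.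
Proof.
  destruct gamma_jordan as [Hper _].
  assert (Hnat : forall (n : nat) t, gamma (t + INR n * (2 * PI)) = gamma t).
  { induction n as [|n IH]; intros t; [f_equal; simpl; ring|].
    rewrite <- (IH t), <- (Hper (t + INR n * (2 * PI))), S_INR. f_equal. ring. }
  destruct (Z.le_gt_cases 0 k) as [Hk|Hk].
  - rewrite <- (Z2Nat.id k Hk), <- INR_IZR_INZ. apply Hnat.
  - rewrite <- (Hnat (Z.to_nat (- k)) (s + IZR k * (2 * PI))), INR_IZR_INZ, Z2Nat.id by lia.
    f_equal. rewrite opp_IZR. ring.
Qed.

Lemma exists_shift (c s : R) : exists k : Z, c <= s + IZR k * (2 * PI) < c + 2 * PI.
Proof.
  pose proof PI_RGT_0. exists (- Int_part ((s - c) / (2 * PI)))%Z.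
  destruct (base_Int_part ((s - c) / (2 * PI))) as [H1 H2].
  set (z := IZR (Int_part ((s - c) / (2 * PI)))) in *.
  rewrite opp_IZR. fold z.
  assert (E : s - c = (s - c) / (2 * PI) * (2 * PI)) by (field; lra).
  set (q := (s - c) / (2 * PI)) in *. split; nra.
Qed.

Lemma gamma_inj (s t : R) : Rabs (s - t) < 2 * PI -> gamma s = gamma t -> s = t.
Proof.
  assert (Hlt : forall s t, s < t -> t - s < 2 * PI -> gamma s <> gamma t).
  { clear s t. intros s t Hst Hd E. pose proof gamma_jordan as [Hper [_ Hinj]].
    destruct (exists_shift 0 s) as [k Hk].
    rewrite <- (gamma_shift k s), <- (gamma_shift k t) in E.
    set (z := IZR k * (2 * PI)) in *.
    destruct (Rlt_le_dec (t + z) (2 * PI)) as [Ht|Ht].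
    - apply Hinj in E; lra.
    - replace (t + z) with (t + z - 2 * PI + 2 * PI) in E by ring.
      rewrite Hper in E. apply Hinj in E; lra. }
  intros Hd E. apply Rabs_def2 in Hd.
  destruct (Rtotal_order s t) as [H|[H|H]]; [exfalso|exact H|exfalso].
  - apply (Hlt s t); lra || exact E.
  - apply (Hlt t s); lra || (symmetry; exact E).
Qed.

(** By compactness: otherwise parameters at distance at least [e] from [s], with images tending to
    [gamma s], cluster at some [x] with [gamma x = gamma s]. As [s] is interior to [[- PI, PI]], [x]
    is less than a period away, so [x = s], a contradiction. *)
Lemma gamma_inverse_continuous (s e : R) :
  Rabs s < PI -> 0 < e ->
  exists d, 0 < d /\ forall t, - PI <= t <= PI ->
    Rabs (fst (gamma t) - fst (gamma s)) < d ->
    Rabs (snd (gamma t) - snd (gamma s)) < d -> Rabs (t - s) < e.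
Proof.
  intros Hs He. apply NNPP. intros Hno.
  destruct (cluster_coordinate (fun d u => - PI <= u 0%nat <= PI /\
    Rabs (fst (gamma (u 0%nat)) - fst (gamma s)) < d /\
    Rabs (snd (gamma (u 0%nat)) - snd (gamma s)) < d /\ e <= Rabs (u 0%nat - s))
    (- PI) PI 0) as [x Hx].
  - intros d d' u Hdd H. lra.
  - intros d Hd. apply NNPP. intros Hno'. apply Hno. exists d. split; [exact Hd|].
    intros t Ht H1 H2. apply Rnot_le_lt. intros H3. apply Hno'. exists (fun _ => t). auto.
  - tauto.
  - assert (Hx' : forall d, 0 < d -> exists t, - PI <= t <= PI /\
      Rabs (fst (gamma t) - fst (gamma s)) < d /\
      Rabs (snd (gamma t) - snd (gamma s)) < d /\ e <= Rabs (t - s) /\ Rabs (t - x) < d).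
    { intros d Hd. destruct (Hx d Hd) as [u Hu]. exists (u 0%nat). tauto. }
    clear Hx. pose proof gamma_jordan as [_ [Hc _]]. destruct (Hc x) as [Hc1 Hc2].
    assert (Hval : forall f : R -> R, continuity_pt f x ->
      (forall d, 0 < d -> exists t, Rabs (f t) < d /\ Rabs (t - x) < d) -> f x = 0).
    { intros f Hf Hz. apply NNPP. intros Hne. apply Rabs_pos_lt in Hne.
      apply continuity_pt_eps with (e := Rabs (f x) / 2) in Hf; [|lra].
      destruct Hf as [d [Hd Hf]].
      destruct (Hz (Rmin d (Rabs (f x) / 2))) as [t [Ht1 Ht2]]; [apply Rmin_pos; lra|].
      specialize (Hf t (Rlt_le_trans _ _ _ Ht2 (Rmin_l _ _))).
      pose proof (Rlt_le_trans _ _ _ Ht1 (Rmin_r _ _)) as Ht3.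
      apply Rabs_def2 in Hf, Ht3.
      destruct (Rcase_abs (f x)) as [Hf0|Hf0];
        [rewrite (Rabs_left _ Hf0) in *|rewrite (Rabs_right _ Hf0) in *]; lra. }
    assert (Hxs : e <= Rabs (x - s) /\ Rabs (x - s) < 2 * PI).
    { apply Rabs_def2 in Hs. split.
      - apply Rnot_lt_le. intros Hlt.
        destruct (Hx' (e - Rabs (x - s))) as [t Ht]; [lra|].
        pose proof (Rabs_triang (t - x) (x - s)) as Htr.
        replace (t - x + (x - s)) with (t - s) in Htr by ring. lra.
      - assert (- PI <= x <= PI); [|apply Rabs_def1; lra].
        split; apply Rnot_lt_le; intros Hlt.
        + destruct (Hx' (- PI - x)) as [t [Ht1 [_ [_ [_ Ht2]]]]]; [lra|].
          apply Rabs_def2 in Ht2. lra.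
        + destruct (Hx' (x - PI)) as [t [Ht1 [_ [_ [_ Ht2]]]]]; [lra|].
          apply Rabs_def2 in Ht2. lra. }
    assert (E : x = s).
    { apply gamma_inj; [tauto|].
      apply injective_projections; apply Rminus_diag_uniq.
      - apply (Hval (fun t => fst (gamma t) - fst (gamma s))).
        + apply continuity_pt_minus; [exact Hc1|now apply continuity_pt_const].
        + intros d Hd. destruct (Hx' d Hd) as [t Ht]. exists t. tauto.
      - apply (Hval (fun t => snd (gamma t) - snd (gamma s))).
        + apply continuity_pt_minus; [exact Hc2|now apply continuity_pt_const].
        + intros d Hd. destruct (Hx' d Hd) as [t Ht]. exists t. tauto. }
    rewrite E, Rminus_diag, Rabs_R0 in Hxs. lra.
Qed.
End Jordan.

(** For a unit vector [(vx, vy)]: the chord from [q] to [p] is zero or makes with it an angle of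
    cosine at least [1 - e]. *)
Definition cone (e vx vy : R) (p q : R * R) : Prop :=
  (1 - e) * pdist p q <= (fst p - fst q) * vx + (snd p - snd q) * vy.

(** The two coordinates are perturbed independently because the mean value theorem supplies a
    separate point for each. *)
Lemma cone_near_direction (P Q e : R) :
  0 < e < 1 -> (P, Q) <> (0, 0) ->
  exists vx vy k, vx ^ 2 + vy ^ 2 = 1 /\ 0 < k /\
    forall p q t a b, Rabs (p - P) < k -> Rabs (q - Q) < k -> 0 <= t ->
      cone e vx vy (a + p * t, b + q * t) (a, b).
Proof.
  intros He Hne.
  assert (HPQ : 0 < P ^ 2 + Q ^ 2).
  { destruct (Req_dec P 0) as [->|HP]; [destruct (Req_dec Q 0) as [->|HQ]|].
    - now destruct Hne.
    - pose proof (pow2_gt_0 Q HQ). lra.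
    - pose proof (pow2_gt_0 P HP). pose proof (pow2_ge_0 Q). lra. }
  set (L := sqrt (P ^ 2 + Q ^ 2)).
  assert (HL : 0 < L) by now apply sqrt_lt_R0.
  assert (HL2 : L ^ 2 = P ^ 2 + Q ^ 2) by (apply pow2_sqrt; lra).
  (* An error [k] per coordinate gives a dot product of at least [(L - 2 * k) * t] and a norm of at
     most [(L + 2 * k) * t]; this [k] ensures [(1 - e) * (L + 2 * k) <= L - 2 * k]. *)
  set (k := e / 4 * L).
  assert (Hk : 0 < k) by (apply Rmult_lt_0_compat; lra).
  exists (P / L), (Q / L), k. split; [|split; [exact Hk|]].
  { replace ((P / L) ^ 2 + (Q / L) ^ 2) with ((P ^ 2 + Q ^ 2) / L ^ 2) by (field; lra).
    rewrite HL2. field. lra. }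
  intros p q t a b Hp Hq Ht. apply Rabs_def2 in Hp, Hq.
  assert (HP : - L <= P <= L).
  { apply Rabs_le_between. rewrite <- sqrt_Rsqr_abs. apply sqrt_le_1_alt.
    rewrite Rsqr_pow2. pose proof (pow2_ge_0 Q). lra. }
  assert (HQ : - L <= Q <= L).
  { apply Rabs_le_between. rewrite <- sqrt_Rsqr_abs. apply sqrt_le_1_alt.
    rewrite Rsqr_pow2. pose proof (pow2_ge_0 P). lra. }
  assert (Hx : - (k * L) <= (p - P) * P <= k * L) by (split; nra).
  assert (Hy : - (k * L) <= (q - Q) * Q <= k * L) by (split; nra).
  assert (Hdot : (L - 2 * k) * t <= p * t * (P / L) + q * t * (Q / L)).
  { replace (p * t * (P / L) + q * t * (Q / L)) with ((p * P + q * Q) / L * t) by (field; lra).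
    apply Rmult_le_compat_r; [exact Ht|].
    apply Rmult_le_reg_r with L; [exact HL|].
    replace ((p * P + q * Q) / L * L) with (p * P + q * Q) by (field; lra). nra. }
  assert (Hnorm : pdist (a + p * t, b + q * t) (a, b) <= (L + 2 * k) * t).
  { unfold pdist. simpl fst. simpl snd.
    rewrite <- (sqrt_pow2 ((L + 2 * k) * t)) by (apply Rmult_le_pos; lra).
    apply sqrt_le_1_alt.
    replace ((a + p * t - a) ^ 2 + (b + q * t - b) ^ 2) with ((p ^ 2 + q ^ 2) * t ^ 2) by ring.
    rewrite Rpow_mult_distr. apply Rmult_le_compat_r; [apply pow2_ge_0|].
    assert ((p - P) ^ 2 <= k ^ 2) by nra. assert ((q - Q) ^ 2 <= k ^ 2) by nra.
    nra. }
  unfold cone. simpl fst. simpl snd.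
  replace (a + p * t - a) with (p * t) by ring. replace (b + q * t - b) with (q * t) by ring.
  apply Rle_trans with (2 := Hdot).
  apply Rle_trans with ((1 - e) * ((L + 2 * k) * t)); [apply Rmult_le_compat_l; lra|].
  rewrite <- Rmult_assoc. apply Rmult_le_compat_r; [exact Ht|]. unfold k. nra.
Qed.

Lemma MVT_is_derive (f df : R -> R) (a b : R) :
  a < b -> (forall x, a <= x <= b -> is_derive f x (df x)) ->
  exists c, a <= c <= b /\ f b = f a + df c * (b - a).
Proof.
  intros Hab Hd.
  destruct (MVT_gen f a b df) as [c [Hc E]];
    rewrite ?Rmin_left, ?Rmax_right in * by lra.
  - intros x Hx. apply Hd. lra.
  - intros x Hx. apply derivable_continuous_pt. exists (df x). apply is_derive_Reals, Hd, Hx.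
  - exists c. split; [exact Hc|lra].
Qed.

Lemma C1_curve_cone (h : R -> R * R) (d1 d2 : R -> R) (a b t0 e : R) :
  0 < e < 1 -> a < t0 < b ->
  (forall t, a < t < b ->
     is_derive (fun u => fst (h u)) t (d1 t) /\ is_derive (fun u => snd (h u)) t (d2 t)) ->
  continuous d1 t0 -> continuous d2 t0 -> (d1 t0, d2 t0) <> (0, 0) ->
  exists vx vy r, vx ^ 2 + vy ^ 2 = 1 /\ 0 < r /\ a <= t0 - r /\ t0 + r <= b /\
    forall t t', t0 - r < t -> t <= t' -> t' < t0 + r -> cone e vx vy (h t') (h t).
Proof.
  intros He Ht0 Hd Hc1 Hc2 Hne.
  destruct (cone_near_direction _ _ e He Hne) as [vx [vy [k [Hv [Hk Hcone]]]]].
  apply continuity_pt_filterlim, continuity_pt_eps with (e := k) in Hc1; [|exact Hk].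
  apply continuity_pt_filterlim, continuity_pt_eps with (e := k) in Hc2; [|exact Hk].
  destruct Hc1 as [r1 [Hr1 Hc1]]. destruct Hc2 as [r2 [Hr2 Hc2]].
  set (r := Rmin (Rmin r1 r2) (Rmin (t0 - a) (b - t0))).
  assert (Hr : 0 < r /\ r <= r1 /\ r <= r2 /\ r <= t0 - a /\ r <= b - t0).
  { split; [repeat apply Rmin_pos; lra|].
    pose proof (Rmin_l (Rmin r1 r2) (Rmin (t0 - a) (b - t0))).
    pose proof (Rmin_r (Rmin r1 r2) (Rmin (t0 - a) (b - t0))).
    pose proof (Rmin_l r1 r2). pose proof (Rmin_r r1 r2).
    pose proof (Rmin_l (t0 - a) (b - t0)). pose proof (Rmin_r (t0 - a) (b - t0)).
    unfold r. lra. }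
  exists vx, vy, r. repeat split; try lra.
  intros t t' H1 [Hlt|Heq] H2.
  - destruct (MVT_is_derive (fun u => fst (h u)) d1 t t' Hlt) as [c1 [Hc1' E1]].
    { intros x Hx. apply Hd. lra. }
    destruct (MVT_is_derive (fun u => snd (h u)) d2 t t' Hlt) as [c2 [Hc2' E2]].
    { intros x Hx. apply Hd. lra. }
    rewrite (surjective_pairing (h t')), (surjective_pairing (h t)), E1, E2.
    apply Hcone; [apply Hc1|apply Hc2|lra]; apply Rabs_def1; lra.
  - subst t'. unfold cone. rewrite pdist_refl, !Rminus_diag. lra.
Qed.

(** The cone condition passes from [h] to [gamma] through the local change of parameter, which is
    continuous and injective, hence monotone, and covers a neighborhood of [0]. *)
Lemma jordan_cone (gamma : R -> R * R) (e : R) :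
  jordan_param gamma -> cont_turning_tangents_at (curve gamma) (gamma 0) -> 0 < e < 1 ->
  exists vx vy d, vx ^ 2 + vy ^ 2 = 1 /\ 0 < d /\
    forall s t, - d <= s -> s <= t -> t <= d -> cone e vx vy (gamma t) (gamma s).
Proof.
  intros HJ [a [b [h [d1 [d2 [_ [HhJ [Hhinj [[t0 [Ht0 Eh]] [_ Hder]]]]]]]]]] He.
  destruct (Hder t0 Ht0) as [_ [_ [Hcd1 [Hcd2 Hne]]]].
  destruct (C1_curve_cone h d1 d2 a b t0 e He Ht0) as [vx [vy [r [Hv [Hr [Hra [Hrb Hcone]]]]]]];
    try assumption.
  { intros t Ht. split; apply (Hder t Ht). }
  assert (Hhc : forall t, a < t < b ->
    continuity_pt (fun u => fst (h u)) t /\ continuity_pt (fun u => snd (h u)) t).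
  { intros t Ht. destruct (Hder t Ht) as [H1 [H2 _]].
    split; apply derivable_continuous_pt; eexists; apply is_derive_Reals; eassumption. }
  pose proof PI_RGT_0 as HPI0. pose proof PI2_1 as HPI1.
  assert (H0 : Rabs 0 < PI) by (rewrite Rabs_R0; lra).
  (* Curve points near [gamma 0] have a parameter within [1] of [0]; as [1 < PI], the inverse is
     continuous at these parameters too. *)
  destruct (gamma_inverse_continuous gamma HJ 0 1 H0 Rlt_0_1) as [d [Hd Hinv0]].
  destruct (Hhc t0 Ht0) as [Hh1 Hh2].
  apply continuity_pt_eps with (e := d) in Hh1; [|exact Hd].
  apply continuity_pt_eps with (e := d) in Hh2; [|exact Hd].
  destruct Hh1 as [r1 [Hr1 Hh1]]. destruct Hh2 as [r2 [Hr2 Hh2]].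
  set (r' := Rmin r (Rmin r1 r2)).
  assert (Hr' : 0 < r' /\ r' <= r /\ r' <= r1 /\ r' <= r2).
  { split; [repeat apply Rmin_pos; lra|].
    pose proof (Rmin_l r (Rmin r1 r2)). pose proof (Rmin_r r (Rmin r1 r2)).
    pose proof (Rmin_l r1 r2). pose proof (Rmin_r r1 r2). unfold r'. lra. }
  (* [w] is the local expression of [gamma^-1 o h]. *)
  set (w := fun t => epsilon (inhabits 0) (fun s => Rabs s < 1 /\ gamma s = h t)).
  assert (Hw : forall t, t0 - r' < t < t0 + r' -> Rabs (w t) < 1 /\ gamma (w t) = h t).
  { intros t Ht. apply (epsilon_spec (inhabits 0) (fun s => Rabs s < 1 /\ gamma s = h t)).
    destruct (HhJ t) as [s Hs]; [lra|].
    destruct (exists_shift (- PI) s) as [k Hk].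
    exists (s + IZR k * (2 * PI)). rewrite gamma_shift by exact HJ. split; [|exact Hs].
    rewrite <- (Rminus_0_r (s + _)).
    apply Hinv0; [lra|rewrite gamma_shift by exact HJ; rewrite Hs, <- Eh..].
    - apply Hh1, Rabs_def1; lra.
    - apply Hh2, Rabs_def1; lra. }
  assert (Hw0 : w t0 = 0).
  { destruct (Hw t0) as [Hw1 Hw2]; [lra|]. apply (gamma_inj gamma HJ).
    - rewrite Rminus_0_r. lra.
    - rewrite Hw2. exact Eh. }
  assert (Hwc : forall t, t0 - r' < t < t0 + r' -> continuity_pt w t).
  { intros t Ht. apply continuity_pt_eps. intros x Hx.
    destruct (Hw t Ht) as [Hw1 Hw2].
    destruct (gamma_inverse_continuous gamma HJ (w t) x) as [y [Hy Hinv]]; [lra|lra|].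
    destruct (Hhc t) as [Hht1 Hht2]; [lra|].
    apply continuity_pt_eps with (e := y) in Hht1; [|exact Hy].
    apply continuity_pt_eps with (e := y) in Hht2; [|exact Hy].
    destruct Hht1 as [y1 [Hy1 Hht1]]. destruct Hht2 as [y2 [Hy2 Hht2]].
    set (z := Rmin (Rmin y1 y2) (Rmin (t - (t0 - r')) (t0 + r' - t))).
    exists z. split; [repeat apply Rmin_pos; lra|]. intros u Hu.
    assert (Hz : z <= y1 /\ z <= y2 /\ z <= t - (t0 - r') /\ z <= t0 + r' - t).
    { pose proof (Rmin_l (Rmin y1 y2) (Rmin (t - (t0 - r')) (t0 + r' - t))).
      pose proof (Rmin_r (Rmin y1 y2) (Rmin (t - (t0 - r')) (t0 + r' - t))).
      pose proof (Rmin_l y1 y2). pose proof (Rmin_r y1 y2).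
      pose proof (Rmin_l (t - (t0 - r')) (t0 + r' - t)).
      pose proof (Rmin_r (t - (t0 - r')) (t0 + r' - t)). unfold z. lra. }
    destruct (Hw u) as [Hu1 Hu2]; [apply Rabs_def2 in Hu; lra|].
    apply Hinv.
    - apply Rabs_def2 in Hu1. lra.
    - rewrite Hu2, Hw2. apply Hht1. lra.
    - rewrite Hu2, Hw2. apply Hht2. lra. }
  assert (Hwinj : forall x y, t0 - r' < x < t0 + r' -> t0 - r' < y < t0 + r' ->
    w x = w y -> x = y).
  { intros x y Hx Hy E. apply Hhinj; [lra|lra|].
    rewrite <- (proj2 (Hw x Hx)), <- (proj2 (Hw y Hy)), E. reflexivity. }
  destruct (continuous_injective_monotone w (t0 - r') (t0 + r') Hwc Hwinj) as [Hmon|Hmon].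
  - destruct (increasing_onto_nbhd w (t0 - r') (t0 + r') t0) as [x [Hx Honto]];
      [lra|exact Hwc|exact Hmon|].
    exists vx, vy, x. split; [exact Hv|]. split; [exact Hx|].
    intros s t Hs Hst Ht. rewrite Hw0 in Honto.
    destruct (Honto s) as [u [Hu Eu]]; [lra|].
    destruct (Honto t) as [u' [Hu' Eu']]; [lra|].
    rewrite <- Eu, <- Eu', (proj2 (Hw u Hu)), (proj2 (Hw u' Hu')).
    apply Hcone; try lra.
    apply Rnot_lt_le. intros Hlt. specialize (Hmon u' u). lra.
  (* If [w] decreases, [h] runs against [gamma] and the direction is reversed. *)
  - destruct (increasing_onto_nbhd (fun t => - w t) (t0 - r') (t0 + r') t0) as [x [Hx Honto]].
    + lra.
    + intros t Ht. now apply continuity_pt_opp, Hwc.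
    + intros u v H1 H2 H3. specialize (Hmon u v). lra.
    + exists (- vx), (- vy), x. split; [rewrite <- Hv; ring|]. split; [exact Hx|].
      intros s t Hs Hst Ht. rewrite Hw0 in Honto.
      destruct (Honto (- s)) as [u [Hu Eu]]; [lra|].
      destruct (Honto (- t)) as [u' [Hu' Eu']]; [lra|].
      replace s with (w u) by lra. replace t with (w u') by lra.
      rewrite (proj2 (Hw u Hu)), (proj2 (Hw u' Hu')).
      assert (Hc : cone e vx vy (h u) (h u')).
      { apply Hcone; try lra.
        apply Rnot_lt_le. intros Hlt. specialize (Hmon u u'). lra. }
      unfold cone in *. rewrite pdist_sym. lra.
Qed.

(** * Inscribed polygons *)

Lemma sum_indicator (c : R) (k m : nat) :
  (k <= m)%nat -> sum_f_R0 (fun j => if Nat.eq_dec j k then c else 0) m = c.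
Proof.
  induction m as [|m IH]; intros Hk.
  - replace k with 0%nat by lia. reflexivity.
  - rewrite tech5. destruct (Nat.eq_dec (S m) k) as [<-|Hne].
    + rewrite sum_eq_R0; [ring|]. intros j Hj. destruct (Nat.eq_dec j (S m)); [lia|reflexivity].
    + rewrite IH by lia. ring.
Qed.

Lemma sum_except_minus (a : nat -> R) (m k : nat) :
  (k <= m)%nat -> sum_except a (S m) (S k) = sum_f_R0 (fun j => a (S j)) m - a (S k).
Proof.
  intros Hk. unfold sum_except. replace (S m - 1)%nat with m by lia.
  rewrite <- (sum_indicator (a (S k)) k m Hk), <- minus_sum. apply sum_eq. intros j Hj.
  destruct (Nat.eq_dec (S j) (S k)) as [E|Hne], (Nat.eq_dec j k) as [E'|Hne']; try lia.
  - subst j. ring.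
  - ring.
Qed.

Lemma sum_lt (f g : nat -> R) (m k : nat) :
  (forall j, (j <= m)%nat -> f j <= g j) -> (k <= m)%nat -> f k < g k ->
  sum_f_R0 f m < sum_f_R0 g m.
Proof.
  induction m as [|m IH]; intros Hle Hk Hlt; simpl.
  - replace 0%nat with k by lia. exact Hlt.
  - destruct (Nat.eq_dec k (S m)) as [->|Hne].
    + apply Rplus_le_lt_compat; [apply sum_Rle; auto|exact Hlt].
    + apply Rplus_lt_le_compat; [apply IH; auto; lia|auto].
Qed.

Lemma sum_telescope (f : nat -> R) (m : nat) :
  sum_f_R0 (fun j => f (S j) - f j) m = f (S m) - f 0%nat.
Proof. induction m as [|m IH]; simpl; [reflexivity|rewrite IH; ring]. Qed.

Lemma sum_scal (c : R) (f : nat -> R) (m : nat) :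
  sum_f_R0 (fun j => c * f j) m = c * sum_f_R0 f m.
Proof. rewrite scal_sum. apply sum_eq. intros. ring. Qed.

(** Finitely many strict inequalities share a margin, the minimum of the [1 - x k / y k]. It will
    serve as the cone parameter. *)
Lemma uniform_slack (x y : nat -> R) (m : nat) :
  (forall k, (k <= m)%nat -> 0 < x k < y k) ->
  exists e, 0 < e < 1 /\ forall k, (k <= m)%nat -> x k <= (1 - e) * y k.
Proof.
  assert (Hone : forall k, 0 < x k < y k -> exists e, 0 < e < 1 /\ x k <= (1 - e) * y k).
  { intros k Hk. exists (1 - x k / y k).
    replace ((1 - (1 - x k / y k)) * y k) with (x k) by (field; lra).
    assert (0 < x k / y k < 1); [|lra]. split.
    - apply Rdiv_lt_0_compat; lra.
    - apply Rmult_lt_reg_r with (y k); [lra|].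
      replace (x k / y k * y k) with (x k) by (field; lra). lra. }
  induction m as [|m IH]; intros H.
  - destruct (Hone 0%nat) as [e [He Hx]]; [apply H; lia|]. exists e. split; [exact He|].
    intros k Hk. now replace k with 0%nat by lia.
  - destruct IH as [e [He IH]]; [intros; apply H; lia|].
    destruct (Hone (S m)) as [e' [He' Hx]]; [apply H; lia|].
    exists (Rmin e e'). pose proof (Rmin_l e e'). pose proof (Rmin_r e e').
    split; [split; [apply Rmin_pos; lra|lra]|]. intros k Hk. pose proof (H k Hk).
    destruct (Nat.eq_dec k (S m)) as [->|Hne].
    + apply Rle_trans with (1 := Hx). apply Rmult_le_compat_r; lra.
    + apply Rle_trans with (1 := IH k ltac:(lia)). apply Rmult_le_compat_r; lra.
Qed.

(** * Continuity of the side lengths *)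

Lemma pdist_triangle (p q r : R * R) : pdist p r <= pdist p q + pdist q r.
Proof.
  pose proof (triangle (fst p) (snd p) (fst r) (snd r) (fst q) (snd q)) as H.
  unfold dist_euc in H. rewrite !Rsqr_pow2 in H. exact H.
Qed.

Lemma pdist_le_abs (p q : R * R) :
  pdist p q <= Rabs (fst p - fst q) + Rabs (snd p - snd q).
Proof.
  unfold pdist. set (x := fst p - fst q). set (y := snd p - snd q).
  pose proof (Rabs_pos x). pose proof (Rabs_pos y).
  rewrite <- (sqrt_pow2 (Rabs x + Rabs y)) by lra.
  apply sqrt_le_1_alt. rewrite <- (pow2_abs x), <- (pow2_abs y). nra.
Qed.

(** Only the coordinates [0] to [n] are compared, as a partition into [n] pieces constrains no
    others. *)
Definition coord_continuous (n : nat) (F : (nat -> R) -> R) (l : nat -> R) : Prop :=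
  forall e, 0 < e -> exists d, 0 < d /\
    forall u, (forall j, (j <= n)%nat -> Rabs (u j - l j) < d) -> Rabs (F u - F l) < e.

Lemma coord_continuous_plus (n : nat) (F G : (nat -> R) -> R) (l : nat -> R) :
  coord_continuous n F l -> coord_continuous n G l ->
  coord_continuous n (fun u => F u + G u) l.
Proof.
  intros HF HG e He. destruct (HF (e / 2)) as [d [Hd HF']]; [lra|].
  destruct (HG (e / 2)) as [d' [Hd' HG']]; [lra|].
  exists (Rmin d d'). split; [apply Rmin_pos; lra|]. intros u Hu.
  pose proof (HF' u (fun j Hj => Rlt_le_trans _ _ _ (Hu j Hj) (Rmin_l d d'))) as H1.
  pose proof (HG' u (fun j Hj => Rlt_le_trans _ _ _ (Hu j Hj) (Rmin_r d d'))) as H2.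
  apply Rabs_def2 in H1, H2. apply Rabs_def1; lra.
Qed.

Lemma coord_continuous_scal (n : nat) (c : R) (F : (nat -> R) -> R) (l : nat -> R) :
  coord_continuous n F l -> coord_continuous n (fun u => c * F u) l.
Proof.
  intros HF e He. pose proof (Rabs_pos c).
  (* The added [1] covers the case [c = 0]. *)
  destruct (HF (e / (Rabs c + 1))) as [d [Hd HF']]; [apply Rdiv_lt_0_compat; lra|].
  exists d. split; [exact Hd|]. intros u Hu. specialize (HF' u Hu).
  rewrite <- Rmult_minus_distr_l, Rabs_mult.
  apply Rmult_lt_compat_r with (r := Rabs c + 1) in HF'; [|lra].
  replace (e / (Rabs c + 1) * (Rabs c + 1)) with e in HF' by (field; lra).
  pose proof (Rabs_pos (F u - F l)). nra.
Qed.

Lemma coord_continuous_sum (n : nat) (F : nat -> (nat -> R) -> R) (l : nat -> R) (m : nat) :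
  (forall j, (j <= m)%nat -> coord_continuous n (F j) l) ->
  coord_continuous n (fun u => sum_f_R0 (fun j => F j u) m) l.
Proof.
  induction m as [|m IH]; intros H; simpl; [now apply H|].
  apply coord_continuous_plus; auto.
Qed.

Lemma coord_continuous_limit_le (n : nat) (F : (nat -> R) -> R) (l : nat -> R) (c : R) :
  coord_continuous n F l ->
  (forall e, 0 < e -> exists u, F u <= c /\ forall j, (j <= n)%nat -> Rabs (u j - l j) < e) ->
  F l <= c.
Proof.
  intros HF Hu. apply Rnot_lt_le. intros Hlt.
  destruct (HF (F l - c)) as [d [Hd HF']]; [lra|].
  destruct (Hu d Hd) as [u [Hc Hud]]. specialize (HF' u Hud). apply Rabs_def2 in HF'. lra.
Qed.

Section Inscribed.
Variable gamma : R -> R * R.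
Hypothesis gamma_jordan : jordan_param gamma.

Definition side (k : nat) (s : nat -> R) : R := pdist (gamma (s (S k))) (gamma (s k)).

Lemma gamma_continuous (t e : R) :
  0 < e -> exists d, 0 < d /\ forall u, Rabs (u - t) < d -> pdist (gamma u) (gamma t) < e.
Proof.
  intros He. pose proof gamma_jordan as [_ [Hc _]]. destruct (Hc t) as [H1 H2].
  apply continuity_pt_eps with (e := e / 2) in H1; [|lra].
  apply continuity_pt_eps with (e := e / 2) in H2; [|lra].
  destruct H1 as [d1 [Hd1 H1]]. destruct H2 as [d2 [Hd2 H2]].
  exists (Rmin d1 d2). split; [apply Rmin_pos; lra|]. intros u Hu.
  specialize (H1 u (Rlt_le_trans _ _ _ Hu (Rmin_l _ _))).
  specialize (H2 u (Rlt_le_trans _ _ _ Hu (Rmin_r _ _))).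
  apply Rle_lt_trans with (1 := pdist_le_abs _ _). lra.
Qed.

Lemma side_continuous (n k : nat) (l : nat -> R) :
  (k < n)%nat -> coord_continuous n (side k) l.
Proof.
  intros Hk e He.
  destruct (gamma_continuous (l k) (e / 2)) as [d1 [Hd1 H1]]; [lra|].
  destruct (gamma_continuous (l (S k)) (e / 2)) as [d2 [Hd2 H2]]; [lra|].
  exists (Rmin d1 d2). split; [apply Rmin_pos; lra|]. intros u Hu.
  specialize (H1 _ (Rlt_le_trans _ _ _ (Hu k ltac:(lia)) (Rmin_l _ _))).
  specialize (H2 _ (Rlt_le_trans _ _ _ (Hu (S k) Hk) (Rmin_r _ _))).
  unfold side.
  set (p := gamma (u (S k))) in *. set (q := gamma (u k)) in *.
  set (p' := gamma (l (S k))) in *. set (q' := gamma (l k)) in *.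
  pose proof (pdist_triangle p p' q). pose proof (pdist_triangle p' q' q).
  pose proof (pdist_triangle p' p q'). pose proof (pdist_triangle p q q').
  rewrite (pdist_sym p' p) in *. rewrite (pdist_sym q' q) in *.
  apply Rabs_def1; lra.
Qed.

(* If one piece [k] fills nearly the whole circle, all the vertices lie in the cone
   neighbourhood of [gamma 0], and the [k]-th side nearly equals the sum of the others. *)
Lemma long_piece_side (e vx vy d : R) (m k : nat) (s : nat -> R) :
  vx ^ 2 + vy ^ 2 = 1 ->
  (forall u t, - d <= u -> u <= t -> t <= d -> cone e vx vy (gamma t) (gamma u)) ->
  partition (2 * PI) (S m) s -> (k <= m)%nat -> 2 * PI - d < s (S k) - s k ->
  (1 - e) * (sum_f_R0 (fun j => side j s) m - side k s) <= side k s.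
Proof.
  intros Hv Hcone Hs Hk Hlong.
  (* Position of the [j]-th vertex along [v]; its increments sum to [0] because the polygon closes
     up. *)
  set (D := fun j => fst (gamma (s j)) * vx + snd (gamma (s j)) * vy).
  assert (Hper : forall t, gamma (t - 2 * PI) = gamma t).
  { intros t. pose proof gamma_jordan as [Hper _]. rewrite <- (Hper (t - 2 * PI)). f_equal. ring. }
  assert (Htotal : sum_f_R0 (fun j => D (S j) - D j) m = 0).
  { rewrite sum_telescope. unfold D. destruct Hs as [H0 [Hn _]].
    rewrite H0, Hn, <- (Hper (2 * PI)), Rminus_diag. ring. }
  (* At [j = k] the correction turns [(1 - e) * side k s] into [- side k s], so each term is at most
     the corresponding increment of [D]. *)
  assert (Hle : sum_f_R0 (fun j => (1 - e) * side j s -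
      (if Nat.eq_dec j k then (2 - e) * side k s else 0)) m <= 0).
  { rewrite <- Htotal. apply sum_Rle. intros j Hj.
    pose proof (partition_bounds _ _ _ (S k) Hs ltac:(lia)).
    pose proof (partition_bounds _ _ _ k Hs ltac:(lia)).
    pose proof (partition_bounds _ _ _ j Hs ltac:(lia)).
    pose proof (partition_bounds _ _ _ (S j) Hs ltac:(lia)).
    pose proof (partition_incr _ _ _ j (S j) Hs ltac:(lia)).
    destruct (Nat.eq_dec j k) as [->|Hne].
    - pose proof (dot_le_pdist (gamma (s (S k))) (gamma (s k)) (- vx) (- vy)
        ltac:(rewrite <- Hv; ring)). unfold side, D in *. lra.
    - destruct (Nat.lt_ge_cases j k) as [Hjk|Hjk].
      + pose proof (partition_incr _ _ _ (S j) k Hs ltac:(lia)).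
        pose proof (Hcone (s j) (s (S j)) ltac:(lra) ltac:(lra) ltac:(lra)).
        unfold cone, side, D in *. lra.
      + pose proof (partition_incr _ _ _ (S k) j Hs ltac:(lia)).
        (* Past the long piece, parameters are moved back by a period into [[- d, 0]]. *)
        pose proof (Hcone (s j - 2 * PI) (s (S j) - 2 * PI) ltac:(lra) ltac:(lra) ltac:(lra)).
        rewrite !Hper in *. unfold cone, side, D in *. lra. }
  rewrite minus_sum, sum_indicator, sum_scal in Hle by exact Hk. lra.
Qed.
End Inscribed.

(** * Proportional sides from the covering theorem *)

Theorem theorem1p2 (gamma : R -> R * R) (n : nat) (a : nat -> R) :
  jordan_param gamma ->
  cont_turning_tangents_at (curve gamma) (gamma 0) ->
  (3 <= n)%nat ->
  (forall i, (1 <= i <= n)%nat -> 0 < a i) ->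
  (forall i, (1 <= i <= n)%nat -> a i < sum_except a n i) ->
  exists (sigma : nat -> R) (lambda : R),
    sigma 0%nat = 0 /\ sigma n = 2 * PI /\
    (forall i, (1 <= i <= n)%nat -> sigma (i - 1)%nat < sigma i) /\
    0 < lambda /\
    (forall i, (1 <= i <= n)%nat ->
       pdist (gamma (sigma i)) (gamma (sigma (i - 1)%nat)) = lambda * a i).
Proof.
  intros HJ HT Hn Hpos Hpoly. destruct n as [|m]; [lia|].
  set (b := fun k => a (S k)). set (B := sum_f_R0 b m).
  assert (Hb : forall k, (k <= m)%nat -> 0 < b k < B - b k).
  { intros k Hk. split; [apply Hpos; lia|].
    unfold B, b. rewrite <- sum_except_minus by exact Hk. apply Hpoly. lia. }
  assert (HB : 0 < B) by (pose proof (Hb 0%nat ltac:(lia)); lra).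
  (* This [e] satisfies [b k <= (1 - e) * (B - b k)]: the polygon inequality with room for the
     distortion of the cone. *)
  destruct (uniform_slack b (fun k => B - b k) m Hb) as [e [He Hslack]].
  destruct (jordan_cone gamma e HJ HT He) as [vx [vy [d0 [Hv [Hd0 Hcone]]]]].
  pose proof PI2_1 as HPI.
  (* The bound [1] gives [d <= 2 * PI - d], so at most one piece is longer than [2 * PI - d]. *)
  set (d := Rmin d0 1). assert (Hd : 0 < d <= 1 /\ d <= d0).
  { pose proof (Rmin_l d0 1). pose proof (Rmin_r d0 1). unfold d.
    split; [split; [apply Rmin_pos; lra|lra]|lra]. }
  set (total := fun s => sum_f_R0 (fun j => side gamma j s) m).
  assert (Hside : forall j s, 0 <= side gamma j s) by (intros; apply pdist_nonneg).
  assert (Htotal : forall s, 0 <= total s) by (intros; apply cond_pos_sum; auto).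
  assert (Hsum1 : forall s, sum_f_R0 (fun j => B * side gamma j s) m = B * total s).
  { intros s. apply sum_scal. }
  assert (Hsum2 : forall s, sum_f_R0 (fun j => b j * total s) m = B * total s).
  { intros s. rewrite Rmult_comm. unfold B. rewrite <- sum_scal.
    apply sum_eq. intros. ring. }
  (* The length bound excludes the degenerate partition in which one piece is the whole circle and
     all sides vanish. *)
  destruct (partition_kkm (2 * PI) (S m) (fun i s =>
    B * side gamma i s <= b i * total s /\ s (S i) - s i <= 2 * PI - d))
    as [s [Hs HK]].
  - lra.
  - lia.
  - intros i l Hi Hl. split.
    + assert (Hlim : B * side gamma i l + - b i * total l <= 0); [|lra].
      apply (coord_continuous_limit_le (S m) (fun u => B * side gamma i u + - b i * total u)).
      * apply coord_continuous_plus; apply coord_continuous_scal.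
        -- now apply side_continuous.
        -- apply coord_continuous_sum. intros j Hj. apply side_continuous; [exact HJ|lia].
      * intros x Hx. destruct (Hl x Hx) as [u [_ [[Hu _] Hul]]]. exists u.
        split; [lra|exact Hul].
    + apply Rnot_lt_le. intros Hlt.
      destruct (Hl ((l (S i) - l i - (2 * PI - d)) / 2)) as [u [_ [[_ Hu] Hul]]]; [lra|].
      destruct (Rabs_def2 _ _ (Hul i ltac:(lia))). destruct (Rabs_def2 _ _ (Hul (S i) Hi)). lra.
  - intros s Hs.
    destruct (classic (exists k, (k <= m)%nat /\ 2 * PI - d < s (S k) - s k))
      as [[k [Hk Hlong]]|Hno].
    + assert (Hbig : (1 - e) * (total s - side gamma k s) <= side gamma k s).
      { apply (long_piece_side gamma HJ e vx vy d); try assumption.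
        intros u t H1 H2 H3. apply Hcone; lra. }
      assert (Hrest : 0 <= total s - side gamma k s).
      { unfold total. rewrite <- (sum_indicator (side gamma k s) k m Hk), <- minus_sum.
        apply cond_pos_sum. intros j. destruct (Nat.eq_dec j k) as [->|Hne].
        - lra.
        - rewrite Rminus_0_r. apply Hside. }
      (* Let [R] be the sum of the other sides. Then [b k * R <= (1 - e) * (B - b k) * R <= (B - b
         k) * side gamma k s], and [b k * side gamma k s] is added. *)
      assert (Hk' : b k * total s <= B * side gamma k s).
      { specialize (Hslack k Hk). specialize (Hb k Hk). nra. }
      apply NNPP. intros Hno.
      assert (Hother : forall j, (j <= m)%nat -> j <> k -> b j * total s < B * side gamma j s).
      { intros j Hj Hjk. apply Rnot_le_lt. intros Hle. apply Hno. exists j.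
        split; [lia|]. split; [exact Hle|].
        pose proof (partition_bounds _ _ _ (S k) Hs ltac:(lia)).
        pose proof (partition_bounds _ _ _ k Hs ltac:(lia)).
        pose proof (partition_bounds _ _ _ j Hs ltac:(lia)).
        pose proof (partition_bounds _ _ _ (S j) Hs ltac:(lia)).
        destruct (Nat.lt_ge_cases j k) as [Hjk1|Hjk1].
        - pose proof (partition_incr _ _ _ (S j) k Hs ltac:(lia)). lra.
        - pose proof (partition_incr _ _ _ (S k) j Hs ltac:(lia)). lra. }
      assert (Hlt : sum_f_R0 (fun j => b j * total s) m < sum_f_R0 (fun j => B * side gamma j s) m).
      { apply sum_lt with (k := if Nat.eq_dec k 0 then 1%nat else 0%nat).
        - intros j Hj. destruct (Nat.eq_dec j k) as [->|Hne]; [exact Hk'|].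
          now apply Rlt_le, Hother.
        - destruct (Nat.eq_dec k 0); lia.
        - destruct (Nat.eq_dec k 0); apply Hother; lia. }
      rewrite Hsum1, Hsum2 in Hlt. lra.
    + apply NNPP. intros Hno'.
      assert (Hlt : forall j, (j <= m)%nat -> b j * total s < B * side gamma j s).
      { intros j Hj. apply Rnot_le_lt. intros Hle. apply Hno'. exists j.
        split; [lia|]. split; [exact Hle|].
        apply Rnot_lt_le. intros Hlt. apply Hno. now exists j. }
      assert (Hlt' : sum_f_R0 (fun j => b j * total s) m < sum_f_R0 (fun j => B * side gamma j s) m).
      { apply sum_lt with (k := 0%nat); [|lia|apply Hlt; lia].
        intros j Hj. now apply Rlt_le, Hlt. }
      rewrite Hsum1, Hsum2 in Hlt'. lra.
  - assert (Hle : forall j, (j <= m)%nat -> B * side gamma j s <= b j * total s).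
    { intros j Hj. destruct (HK j) as [E|[H _]]; [lia| |exact H].
      unfold side. rewrite E, pdist_refl, Rmult_0_r.
      apply Rmult_le_pos; [|apply Htotal]. specialize (Hb j Hj). lra. }
    assert (Heq : forall j, (j <= m)%nat -> B * side gamma j s = b j * total s).
    { intros j Hj. apply Rle_antisym; [now apply Hle|]. apply Rnot_lt_le. intros Hlt.
      pose proof (sum_lt (fun j => B * side gamma j s) (fun j => b j * total s) m j Hle Hj Hlt) as H.
      rewrite Hsum1, Hsum2 in H. lra. }
    pose proof Hs as [Hs0 [Hsn Hincr]].
    assert (Hshort : forall j, (j <= m)%nat -> s (S j) - s j < 2 * PI).
    { intros j Hj. destruct (HK j) as [E|[_ H]]; [lia| |]; lra. }
    (* Otherwise all sides vanish and, each piece being shorter than a period, all vertices share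
       one parameter, against [s (S m) = 2 * PI]. *)
    assert (Hpos_total : 0 < total s).
    { destruct (Htotal s) as [H|H]; [exact H|exfalso].
      assert (Hconst : forall j, (j <= S m)%nat -> s j = 0).
      { induction j as [|j IH]; intros Hj; [exact Hs0|].
        rewrite <- IH by lia. pose proof (Hshort j ltac:(lia)).
        pose proof (Hincr j ltac:(lia)). pose proof (Heq j ltac:(lia)) as E.
        rewrite <- H, Rmult_0_r in E.
        apply Rmult_integral in E as [E|E]; [lra|].
        apply (gamma_inj gamma HJ); [rewrite Rabs_pos_eq; lra|].
        now apply pdist_eq0. }
      rewrite (Hconst (S m) ltac:(lia)) in Hsn. lra. }
    assert (Hsol : forall j, (j <= m)%nat -> side gamma j s = total s / B * b j).
    { intros j Hj. apply Rmult_eq_reg_l with B; [|lra]. rewrite Heq by exact Hj. field. lra. }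
    assert (Hlam : 0 < total s / B) by (apply Rdiv_lt_0_compat; lra).
    exists s, (total s / B). repeat split; try assumption.
    + intros [|j] Hi; [lia|]. replace (S j - 1)%nat with j by lia.
      (* A piece of length zero would have side zero, but [total s / B * b j] is positive. *)
      destruct (Hincr j ltac:(lia)) as [H|E]; [exact H|exfalso].
      pose proof (Hsol j ltac:(lia)) as H. unfold side in H.
      rewrite <- E, pdist_refl in H.
      pose proof (Rmult_lt_0_compat _ _ Hlam (proj1 (Hb j ltac:(lia)))). lra.
    + intros [|j] Hi; [lia|]. replace (S j - 1)%nat with j by lia.
      apply Hsol. lia.
Qed.
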